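(* Let $f:\mathbb{R}^n\to\mathbb{R}$ and the randomized stochastic quasi-Newton method RSQN, with the matrices $B_{k+1}$ generated by the stochastic damped-BFGS procedure SDBFGS, be such that AS.1, AS.2, AS.3 and AS.4 hold. Let $\epsilon>0$, let $\tilde D>0$ be a constant, and put $D_f:=f(x_1)-f^{low}$, $$C_1=\frac{4\sigma M^2D_f}{m^2\sqrt{\tilde D}}+\sigma L\sqrt{\tilde D},\qquad C_2=\frac{4LM^2D_f}{m^2}.$$ Let the positive integer $\bar N$ satisfy $$\bar N\ge\max\left\{\frac{C_1^2}{\epsilon^2}+\frac{4C_2}{\epsilon},\ \frac{\sigma^2}{L^2\tilde D}\right\},$$ and run the method with constant batch size $$m_k=\bar m:=\left\lceil\min\left\{\bar N,\max\left\{1,\frac{\sigma}{L}\sqrt{\frac{\bar N}{\tilde D}}\right\}\right\}\right\rceil,$$ maximum iteration number $N=\lfloor\bar N/\bar m\rfloor$, stepsizes $\alpha_k=m/(LM^2)$ for $k=1,\dots,N$, and $$P_R(k)=\frac{m\alpha_k-LM^2\alpha_k^2/2}{\sum_{j=1}^N(m\alpha_j-LM^2\alpha_j^2/2)},\qquad k=1,\dots,N.$$ Let $N_{sfo}$ be the total number of oracle calls made by the method (both for computing the $G_k$ and for generating the $B_{k+1}$). Then $\mathbb{E}[\|\nabla f(x_R)\|^2]\le\epsilon$ is achieved with $N_{sfo}\le2\bar N$; that is, to achieve $\mathbb{E}[\|\nabla f(x_R)\|^2]\le\epsilon$, $N_{sfo}$ is at most of order $O(\epsilon^{-2})$ (as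 $\epsilon\to0$, with the other parameters fixed).
   Context: Problem: minimize a (possibly nonconvex) $f$ over $\mathbb{R}^n$, using only stochastic gradients $G(x,\xi)\in\mathbb{R}^n$ returned by calls to a stochastic first-order oracle (one call per evaluation of $G(x,\xi)$), where $\xi$ is a random variable whose distribution is supported on a set $\Xi\subseteq\mathbb{R}^d$ not depending on $x$. Algorithm RSQN. Given: a maximum iteration number $N$, a (deterministic) point $x_1\in\mathbb{R}^n$, a positive definite $B_1\in\mathbb{R}^{n\times n}$, stepsizes $\alpha_k$, batch sizes $m_k\ge1$ (integers), positive safeguard parameters $\zeta_k$. Choose $R$ at random in $\{1,\dots,N\}$ with probability mass function $P_R$, independently of all the gradient samples. For $k=1,\dots,R$: $$G_k=\frac1{m_k}\sum_{i=1}^{m_k}G(x_k,\xi_{k,i}),\qquad x_{k+1}=x_k-\alpha_k(B_k^{-1}+\zeta_kI)G_k,$$ and then $B_{k+1}$ is generated. The output is $x_R$. (The iterates $x_1,\dots,x_N$ are regarded as defined by this recursion for all $k\le N$.) Write $\xi_k=(\xi_{k,1},\dots,\xi_{k,m_k})$ and $\xi_{[k]}=(\xi_1,\dots,\xi_k)$. The expectation of $\|\nabla f(x_R)\|^2$ is with respect to $R$ and $\xi_{[N]}$. Procedure SDBFGS (with parameter $\delta>0$). Given $B_k,G_k,x_k,x_{k+1},\xi_k$: set $s_k=x_{k+1}-x_k$, $\bar G_{k+1}=\frac1{m_k}\sum_{i=1}^{m_k}G(x_{k+1},\xi_{k,i})$ (this uses $m_k$ additional oracle calls), $\hat y_k=\bar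 G_{k+1}-G_k-\delta s_k$, $\hat r_k=\hat\theta_k\hat y_k+(1-\hat\theta_k)B_ks_k$, where $\hat\theta_k=1$ if $s_k^{\mathsf T}\hat y_k\ge0.2\,s_k^{\mathsf T}B_ks_k$ and $\hat\theta_k=\dfrac{0.8\,s_k^{\mathsf T}B_ks_k}{s_k^{\mathsf T}B_ks_k-s_k^{\mathsf T}\hat y_k}$ otherwise, and $$B_{k+1}=B_k+\frac{\hat r_k\hat r_k^{\mathsf T}}{s_k^{\mathsf T}\hat r_k}-\frac{B_ks_ks_k^{\mathsf T}B_k}{s_k^{\mathsf T}B_ks_k}+\delta I.$$ If $s_k=0$, the two fractions are read as $0$. Assumptions. AS.1: $f$ is continuously differentiable, $f(x)\ge f^{low}$ for all $x\in\mathbb{R}^n$, and $\nabla f$ is globally Lipschitz with constant $L>0$. AS.2: all samples $\xi_{k,i}$ are mutually independent (so $\xi_k$ is independent of $\xi_{[k-1]}$ and hence of $x_k$), and for every $k$ and $i$, taking expectation over $\xi_{k,i}$ with $x_k$ fixed, $\mathbb{E}_{\xi_{k,i}}[G(x_k,\xi_{k,i})]=\nabla f(x_k)$ and $\mathbb{E}_{\xi_{k,i}}[\|G(x_k,\xi_{k,i})-\nabla f(x_k)\|^2]\le\sigma^2$, where $\sigma>0$. AS.3: there are positive scalars $m,M$ with $mI\preceq B_k^{-1}+\zeta_kI\preceq MI$ for all $k$. AS.4: for every $k\ge2$, the random matrix $B_k$ depends only on $\xi_{[k-1]}$. $\|\cdot\|$ is the Euclidean norm. *)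

(* Defs.v *)
From mathcomp Require Import all_boot all_order all_algebra.
From mathcomp Require Import finmap.
From mathcomp Require Import all_classical all_reals all_analysis.

Set Implicit Arguments.
Unset Strict Implicit.
Unset Printing Implicit Defensive.

Import Order.TTheory GRing.Theory Num.Theory.
Import numFieldNormedType.Exports.

Local Open Scope classical_set_scope.
Local Open Scope ring_scope.

Section Vectors.
Context {R : realType} {n : nat}.
Implicit Types (u v x : 'cV[R]_n) (A B : 'M[R]_n).

Definition dotv u v : R := (u^T *m v) 0 0.

(* The library norm `|x| on matrices is the max norm. *)
Definition norm2 u : R := Num.sqrt (\sum_i u i 0 ^+ 2).

Definition posdefmx A : Prop :=
  A^T = A /\ forall u, u != 0 -> 0 < dotv u (A *m u).

Definition possemidefmx A : Prop :=
  A^T = A /\ forall u, 0 <= dotv u (A *m u).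

Definition loewner_le A B : Prop := possemidefmx (B - A).

Definition grad (f : 'cV[R]_n -> R) x : 'cV[R]_n :=
  \col_i 'D_(delta_mx i 0) f x.

Definition smooth_objective (f : 'cV[R]_n -> R) (flow L : R) : Prop :=
  [/\ forall x, differentiable f x,
      continuous (grad f),
      forall x, flow <= f x
    & forall x y, norm2 (grad f x - grad f y) <= L * norm2 (x - y)].

End Vectors.

(* R^n with its Borel sigma-algebra; the library provides none on matrices. *)
Notation borel_cV R n := (g_sigma_algebraType (@open 'cV[R]_n)).

Section Independence.
Context {dT dU : measure_display} {T : measurableType dT}
  {U : measurableType dU} {R : realType} (P : probability T R).

(* the sigma-algebra generated by the variables X i, i in D *)
Definition sigma_of {I : Type} (D : set I) (X : I -> T -> U) : set (set T) :=
  <<s \bigcup_(i in D) preimage_set_system setT (X i) measurable >>.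

Definition mutually_independent {I : choiceType} (D : set I) (X : I -> T -> U)
    : Prop :=
  forall (J : {fset I}) (A : I -> set U),
    [set` J] `<=` D -> (forall i, i \in J -> measurable (A i)) ->
    P (\bigcap_(i in [set` J]) (X i @^-1` A i)) =
    (\prod_(i <- J) P (X i @^-1` A i))%E.

Definition independent_classes (F H : set (set T)) : Prop :=
  forall A B, F A -> H B -> P (A `&` B) = (P A * P B)%E.

End Independence.

Section Algorithm.
Context {R : realType} {n d : nat}.
Context (G : 'cV[R]_n -> 'cV[R]_d -> 'cV[R]_n).

Definition batch_mean (b : nat) (x : 'cV[R]_n) (z : nat -> 'cV[R]_d) :
    'cV[R]_n :=
  b%:R^-1 *: \sum_(i < b) G x (z i).

(* When s = 0 both dotv s r and sBs vanish; since 0^-1 = 0, the two fractions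
   are then 0. *)
Definition sdbfgs (delta : R) (b : nat) (B : 'M[R]_n) (x x' : 'cV[R]_n)
    (z : nat -> 'cV[R]_d) : 'M[R]_n :=
  let s := x' - x in
  let y := batch_mean b x' z - batch_mean b x z - delta *: s in
  let sBs := dotv s (B *m s) in
  let theta :=
    if 2 / 10 * sBs <= dotv s y then 1 else (8 / 10 * sBs) / (sBs - dotv s y) in
  let r := theta *: y + (1 - theta) *: (B *m s) in
  B + (dotv s r)^-1 *: (r *m r^T) - sBs^-1 *: (B *m s *m s^T *m B) + delta%:M.

(* Iteration k makes b k oracle calls for the gradient estimate at x_k and
   another b k, at x_(k+1), for the update of B. *)
Definition sfo_calls (b : nat -> nat) (r : nat) : nat :=
  \sum_(1 <= k < r.+1) (b k + b k).

Definition stop_pmf (m M L : R) (alpha : nat -> R) (N k : nat) : R :=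
  let wt j := m * alpha j - L * M ^+ 2 * alpha j ^+ 2 / 2 in
  wt k / \sum_(1 <= j < N.+1) wt j.

Context {dT : measure_display} {T : measurableType dT} (P : probability T R).

(* Indices (k, i) of the samples: iterations are numbered 1..N, the samples
   of iteration k are numbered 0..(b k - 1). *)
Definition sample_index (b : nat -> nat) (N : nat) : set (nat * nat) :=
  [set p | (1 <= p.1 <= N)%N /\ (p.2 < b p.1)%N].

(* A run of RSQN with SDBFGS updates: the samples xi k i, the iterates x k,
   the matrices B k and the random index tau are functions on the probability
   space T.  In the fields about the oracle the expectation is over the sample
   (variable w') while the iterate x k w is held fixed. *)
Record rsqn_run (f : 'cV[R]_n -> R) (Xi : set 'cV[R]_d) (sigma m M delta : R)
    (x1 : 'cV[R]_n) (B1 : 'M[R]_n) (N : nat) (b : nat -> nat)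
    (alpha pmf zeta : nat -> R) (xi : nat -> nat -> T -> 'cV[R]_d)
    (tau : T -> nat) (x : nat -> T -> 'cV[R]_n) (B : nat -> T -> 'M[R]_n)
    : Prop := {
  run_zeta : forall k, (1 <= k <= N)%N -> 0 < zeta k ;
  run_x1 : forall w, x 1%N w = x1 ;
  run_B1 : forall w, B 1%N w = B1 ;
  run_step : forall k w, (1 <= k <= N)%N ->
    x k.+1 w = x k w - alpha k *:
      ((invmx (B k w) + (zeta k)%:M) *m
        batch_mean (b k) (x k w) (fun i => xi k i w)) ;
  run_sdbfgs : forall k w, (1 <= k <= N)%N ->
    B k.+1 w =
      sdbfgs delta (b k) (B k w) (x k w) (x k.+1 w) (fun i => xi k i w) ;
  run_sample_meas : forall k i, sample_index b N (k, i) ->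
    measurable_fun setT (xi k i : T -> borel_cV R d) ;
  run_sample_supp : forall k i, sample_index b N (k, i) ->
    {ae P, forall w, Xi (xi k i w)} ;
  run_sample_indep :
    mutually_independent P (sample_index b N)
      (fun p => xi p.1 p.2 : T -> borel_cV R d) ;
  run_unbiased : forall k i, sample_index b N (k, i) ->
    {ae P, forall w, forall j,
      ('E_P[(fun w' => G (x k w) (xi k i w') j 0)%R] =
        (grad f (x k w) j 0)%R%:E)%E} ;
  run_variance : forall k i, sample_index b N (k, i) ->
    {ae P, forall w,
      ('E_P[(fun w' => norm2 (G (x k w) (xi k i w') - grad f (x k w)) ^+ 2)%R]
        <= (sigma ^+ 2)%R%:E)%E} ;
  run_bounds : forall k, (1 <= k <= N)%N ->
    {ae P, forall w,
      loewner_le m%:M (invmx (B k w) + (zeta k)%:M) /\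
      loewner_le (invmx (B k w) + (zeta k)%:M) M%:M} ;
  run_adapted : forall k, (2 <= k <= N)%N -> forall (i j : 'I_n) (Y : set R),
    measurable Y ->
    sigma_of (sample_index b k.-1) (fun p => xi p.1 p.2 : T -> borel_cV R d)
      ((fun w => B k w i j) @^-1` Y) ;
  run_tau_meas : measurable_fun setT tau ;
  run_tau_range : forall w, (1 <= tau w <= N)%N ;
  run_tau_law : forall k, (1 <= k <= N)%N ->
    P (tau @^-1` [set k]) = (pmf k)%:E ;
  run_tau_indep :
    independent_classes P (preimage_set_system setT tau measurable)
      (sigma_of (sample_index b N) (fun p => xi p.1 p.2 : T -> borel_cV R d))
}.

End Algorithm.

(* Main.v *)
(* Write a_k for the gradient of f at x_k, e_k for the error of the k-th batch
   mean, and A_k = B_k^-1 + zeta_k I.  The descent lemma together with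
   |A_k v| <= M |v| gives
     f(x_(k+1)) <= f(x_k) - w |a_k|^2 + <c_k, e_k> + (L M^2 alpha^2 / 2) |e_k|^2
   with w = m alpha - L M^2 alpha^2 / 2 and c_k = L M^2 alpha^2 a_k - alpha A_k a_k.
   Both x_k and A_k are functions of the samples of the earlier iterations, so
   each sample of iteration k is independent of c_k and of the other samples;
   freezing these by Fubini's theorem yields E <c_k, e_k> = 0 and
   E |e_k|^2 <= sigma^2 / b_k.  Integrability propagates along the iterations
   because |a_k|^2 <= 2 L (f(x_k) - flow).  Telescoping bounds the sum of the
   E |a_k|^2, and for the constant stepsize the random index is uniform and
   independent of the samples, so E |a_R|^2 is their average. *)
From HB Require Import structures.
Require Import Defs.
From mathcomp Require Import all_boot all_order all_algebra.
From mathcomp Require Import finmap ring lra.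
From mathcomp Require Import all_classical all_reals all_analysis.
From mathcomp Require Import measurable_realfun.

Set Implicit Arguments.
Unset Strict Implicit.
Unset Printing Implicit Defensive.

Import Order.TTheory GRing.Theory Num.Theory.
Import numFieldNormedType.Exports.

Local Open Scope classical_set_scope.
Local Open Scope ring_scope.

(** * Quadratic forms and the descent lemma *)

Section EuclideanAlgebra.
Context {R : realType} {n : nat}.
Implicit Types (u v w a e : 'cV[R]_n) (A : 'M[R]_n).

Lemma dotvE u v : dotv u v = \sum_i u i 0 * v i 0.
Proof. by rewrite /dotv mxE; apply: eq_bigr => i _; rewrite mxE. Qed.

Lemma dotvC u v : dotv u v = dotv v u.
Proof. by rewrite !dotvE; apply: eq_bigr => i _; rewrite mulrC. Qed.

Lemma dotvDr u v w : dotv u (v + w) = dotv u v + dotv u w.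
Proof. by rewrite /dotv mulmxDr mxE. Qed.

Lemma dotvZr c u v : dotv u (c *: v) = c * dotv u v.
Proof. by rewrite /dotv -scalemxAr mxE. Qed.

Lemma dotvNr u v : dotv u (- v) = - dotv u v.
Proof. by rewrite /dotv mulmxN mxE. Qed.

Lemma dotvDl u v w : dotv (u + v) w = dotv u w + dotv v w.
Proof. by rewrite dotvC dotvDr !(dotvC w). Qed.

Lemma dotvZl c u v : dotv (c *: u) v = c * dotv u v.
Proof. by rewrite dotvC dotvZr dotvC. Qed.

Lemma dotvNl u v : dotv (- u) v = - dotv u v.
Proof. by rewrite dotvC dotvNr dotvC. Qed.

Lemma dotv_sumr (I : Type) (s : seq I) u (F : I -> 'cV[R]_n) :
  dotv u (\sum_(i <- s) F i) = \sum_(i <- s) dotv u (F i).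
Proof.
elim: s => [|i s IHs]; first by rewrite !big_nil /dotv mulmx0 mxE.
by rewrite !big_cons dotvDr IHs.
Qed.

Lemma dotvv_ge0 u : 0 <= dotv u u.
Proof.
by rewrite dotvE; apply: sumr_ge0 => i _; rewrite -expr2 sqr_ge0.
Qed.

Lemma norm2_sq u : norm2 u ^+ 2 = dotv u u.
Proof.
rewrite /norm2 sqr_sqrtr; last by apply: sumr_ge0 => i _; exact: sqr_ge0.
by rewrite dotvE; apply: eq_bigr => i _; rewrite expr2.
Qed.

Lemma norm2_ge0 u : 0 <= norm2 u.
Proof. exact: sqrtr_ge0. Qed.

Lemma sqr_coord_le u (j : 'I_n) : u j 0 ^+ 2 <= dotv u u.
Proof.
rewrite dotvE (bigD1 j)//= -expr2 lerDl.
by apply: sumr_ge0 => i _; rewrite -expr2 sqr_ge0.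
Qed.

Lemma dotvvB u v :
  dotv (u - v) (u - v) = dotv u u - 2 * dotv u v + dotv v v.
Proof.
by rewrite dotvDl !dotvDr !dotvNr !dotvNl (dotvC v u); ring.
Qed.

Lemma dotvvD u v :
  dotv (u + v) (u + v) = dotv u u + 2 * dotv u v + dotv v v.
Proof. by rewrite dotvDl !dotvDr (dotvC v u); ring. Qed.

Lemma dotvvZ c u : dotv (c *: u) (c *: u) = c ^+ 2 * dotv u u.
Proof. by rewrite dotvZl dotvZr mulrA expr2. Qed.

Lemma dotv_amgm u v : 2 * dotv u v <= dotv u u + dotv v v.
Proof. by have := dotvv_ge0 (u - v); rewrite dotvvB; lra. Qed.

Lemma dotv_symm A u v : A^T = A -> dotv u (A *m v) = dotv v (A *m u).
Proof.
move=> symA; rewrite dotvC /dotv trmx_mul symA -mulmxA; by [].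
Qed.

Lemma loewner_scal_geP (m : R) A u :
  loewner_le m%:M A -> m * dotv u u <= dotv u (A *m u).
Proof.
move=> [_ /(_ u)]; rewrite mulmxDl mulNmx mul_scalar_mx dotvDr dotvNr dotvZr.
by rewrite subr_ge0.
Qed.

Lemma loewner_scal_leP (M : R) A u :
  loewner_le A M%:M -> dotv u (A *m u) <= M * dotv u u.
Proof.
move=> [_ /(_ u)]; rewrite mulmxDl mulNmx mul_scalar_mx dotvDr dotvNr dotvZr.
by rewrite subr_ge0.
Qed.

Lemma loewner_scal_symm (m : R) A : loewner_le m%:M A -> A^T = A.
Proof.
by move=> [+ _]; rewrite linearB/= tr_scalar_mx => /(congr1 (+%R^~ m%:M)); rewrite !subrK.
Qed.

(* Nonnegativity of the quadratic form at u - M^-1 A u. *)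
Lemma loewner_sqnorm_le (m M : R) A u : 0 < m -> 0 < M ->
  loewner_le m%:M A -> loewner_le A M%:M ->
  dotv (A *m u) (A *m u) <= M ^+ 2 * dotv u u.
Proof.
move=> m0 M0 mA AM.
set v := A *m u.
have symA := loewner_scal_symm mA.
have h1 : 0 <= dotv (u - M^-1 *: v) (A *m (u - M^-1 *: v)).
  apply: le_trans (loewner_scal_geP _ mA).
  by rewrite mulr_ge0 ?dotvv_ge0 ?ltW.
have h2 := loewner_scal_leP v AM.
have h3 := loewner_scal_leP u AM.
move: h1; rewrite mulmxBr -scalemxAr !dotvDl !dotvDr !dotvNr !dotvNl !dotvZr !dotvZl.
rewrite -/v (dotv_symm u v symA) -/v.
move: (dotv v v) (dotv u u) (dotv u v) (dotv v (A *m v)) h2 h3 => vv uu uv vAv h2 h3.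
have -> : uv + - (M^-1 * vv) + (- (M^-1 * vv) - - (M^-1 * (M^-1 * vAv))) =
   uv - 2 * M^-1 * vv + M^-1 * M^-1 * vAv by ring.
have h4 : M^-1 * M^-1 * vAv <= M^-1 * vv.
  rewrite -mulrA; apply: ler_wpM2l; first by rewrite invr_ge0 ltW.
  by rewrite mulrC ler_pdivrMr// mulrC.
move=> h5.
have h6 : M^-1 * vv <= M * uu by lra.
by move: h6; rewrite mulrC ler_pdivrMr// expr2 mulrAC.
Qed.

End EuclideanAlgebra.

Section Descent.
Context {R : realType} {n : nat}.
Context (f : 'cV[R]_n -> R) (flow L : R).
Context (L0 : 0 < L) (fs : smooth_objective f flow L).
Implicit Types x h : 'cV[R]_n.

(** [grad] collects partial derivatives only. Differentiability makes the directional derivative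
    linear in h, so expanding h in the standard basis reaches every direction. *)
Lemma derive_dotv_grad x h : differentiable f x -> 'D_h f x = dotv (grad f x) h.
Proof.
move=> df; rewrite deriveE//.
have {1}-> : h = \sum_i h i 0 *: delta_mx i 0.
  apply/matrixP => i j; rewrite summxE (bigD1 i)//= big1.
    by rewrite addr0 !mxE (ord1 j) !eqxx mulr1.
  by move=> k ki; rewrite !mxE eq_sym (negbTE ki) mulr0.
rewrite linear_sum dotvE; apply: eq_bigr => i _.
by rewrite linearZ/= mxE deriveE// mulrC.
Qed.

Lemma is_derive_line x h (t : R) :
  is_derive t (1 : R) (fun s : R => f (x + s *: h)) (dotv (grad f (x + t *: h)) h).
Proof.
have [df _ _ _] := fs.
have dl : is_diff t (fun s : R => x + s *: h) (fun s => 0 + s *: h).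
  exact: is_diffD.
have dft : is_diff (x + t *: h) f ('d f (x + t *: h)).
  by apply: DiffDef.
have dc : is_diff t (f \o (fun s : R => x + s *: h))
    ('d f (x + t *: h) \o (fun s => 0 + s *: h)).
  exact: is_diff_comp.
apply: DeriveDef; first exact/derivable1_diffP/ex_diff.
rewrite deriveE; last exact: ex_diff.
by rewrite (diff_val (is_diff_def := dc)) /= add0r scale1r -derive_dotv_grad// deriveE.
Qed.

(** Monotonicity replaces integration along the segment: f(x + s h) minus its quadratic model has
    derivative <grad f(x + s h) - grad f(x), h> - L s |h|^2, which is nonpositive by the Lipschitz
    bound. So the difference does not increase on [0, 1]. *)
Lemma descent x h : f (x + h) <= f x + dotv (grad f x) h + L / 2 * dotv h h.
Proof.
have [_ _ _ lip] := fs.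
pose q (s : R) := s * dotv (grad f x) h + L / 2 * dotv h h * s ^+ 2.
pose psi (s : R) := f (x + s *: h) - q s.
have dpsi (t : R) : is_derive t (1 : R) psi
    (dotv (grad f (x + t *: h)) h - (dotv (grad f x) h + L * dotv h h * t)).
  have d1 := is_derive_line x h t.
  have d2 : is_derive t (1 : R) q (dotv (grad f x) h + L * dotv h h * t).
    by apply: is_derive_eq; rewrite /GRing.scale/=; field.
  exact: is_deriveB.
have psi_le : psi 1 <= psi 0.
  apply: (@ler0_derive1_nincr R psi 0 1) => //.
  - move=> t; rewrite in_itv/= => /andP[t0 t1].
    rewrite derive1E derive_val.
    have : dotv (grad f (x + t *: h) - grad f x) h <= L * t * dotv h h.
      (* The arithmetic-geometric inequality, with one vector scaled by (L t)^-1, takes the place of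
         Cauchy-Schwarz. *)
      have c0 : 0 < L * t by rewrite mulr_gt0.
      have := dotv_amgm ((L * t)^-1 *: (grad f (x + t *: h) - grad f x)) h.
      have := lip (x + t *: h) x.
      rewrite -(ler_pXn2r (n := 2))//; last 2 first.
      - by rewrite nnegrE norm2_ge0.
      - by rewrite nnegrE mulr_ge0 ?norm2_ge0// ltW.
      rewrite exprMn !norm2_sq addrAC subrr add0r !dotvvZ dotvZl.
      set g := grad f _ - _; rewrite [L ^+ 2 * _]mulrA -[L ^+ 2 * _]exprMn => Gle.
      have {Gle} : (L * t)^-1 ^+ 2 * dotv g g <= dotv h h.
        by rewrite exprVn mulrC ler_pdivrMr ?exprn_gt0// mulrC.
      move=> h1 h2; have {h1 h2} : (L * t)^-1 * dotv g h <= dotv h h by lra.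
      by rewrite mulrC ler_pdivrMr// mulrC.
    rewrite dotvDl dotvNl => h1; rewrite subr_le0 -lerBlDl; apply: (le_trans h1).
    by rewrite mulrAC.
  - apply: continuous_subspaceT => t; apply: differentiable_continuous.
    exact/derivable1_diffP/ex_derive.
move: psi_le; rewrite /psi /q scale1r scale0r addr0 mul1r expr1n mulr1 mul0r.
by rewrite expr0n/= mulr0 addr0 subr0 lerBlDr addrA.
Qed.

(** By the descent lemma a gradient step of length 1/L lowers f by at least |grad f(x)|^2 / (2 L),
    yet f cannot fall below [flow]. *)
Lemma sqnorm_grad_le x : dotv (grad f x) (grad f x) <= 2 * L * (f x - flow).
Proof.
have [_ _ low _] := fs.
have := descent x (- L^-1 *: grad f x).
have := low (x + - L^-1 *: grad f x).
rewrite dotvvZ dotvZr; set g := dotv _ _ => h1 h2.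
have : flow <= f x - g / (2 * L).
  apply: (le_trans h1); apply: (le_trans h2).
  rewrite le_eqVlt; apply/orP; left; apply/eqP; field; exact: lt0r_neq0.
rewrite lerBrDr -lerBrDl ler_pdivrMr; last by rewrite mulr_gt0.
by rewrite mulrC.
Qed.

End Descent.

(** * Measurability of vector and matrix operations *)

Lemma continuous_borel_cV (R : realType) (n : nat) (h : 'cV[R]_n -> R) :
  continuous h -> measurable_fun setT (h : borel_cV R n -> R).
Proof.
move=> /continuousP ch; apply: (measurability _ (RGenOpens.measurableE R)).
move=> _ [_ [a [b ->] <-]]; rewrite setTI; apply: sub_sigma_algebra.
exact/ch/interval_open.
Qed.

(** Inversion is continuous on the open complement of 0, and every function is measurable on the
    remaining singleton. *)
Lemma measurable_inv_real (R : realType) : measurable_fun setT (fun r : R => r^-1).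
Proof.
rewrite -(setvU [set (0 : R)]); apply/measurable_funU => //.
  exact: measurableC.
split; last first.
  exact: measurable_fun_set1.
apply: open_continuous_measurable_fun.
  exact/closed_openC/accessible_closed_set1/hausdorff_accessible/Rhausdorff.
by move=> r; rewrite inE/= => /eqP r0; exact: inv_continuous.
Qed.

Section ColumnMeasurability.
Context d (T : measurableType d) (R : realType) (n : nat).

Lemma measurable_coord (X : T -> 'cV[R]_n) (j : 'I_n) :
  measurable_fun setT (X : T -> borel_cV R n) ->
  measurable_fun setT (fun w => X w j 0).
Proof.
move=> mX; pose c (x : 'cV[R]_n) : R := x j 0.
have mc : measurable_fun setT (c : borel_cV R n -> R).
  by apply: continuous_borel_cV => x; exact: coord_continuous.
exact: (measurableT_comp mc mX).
Qed.

(* An open set is the countable union of the balls with rational centre and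
   radius that it contains. *)
Lemma measurable_colP (X : T -> 'cV[R]_n) :
  (forall j, measurable_fun setT (fun w => X w j 0)) ->
  measurable_fun setT (X : T -> borel_cV R n).
Proof.
move=> mX.
apply: (@measurability _ _ T (borel_cV R n) setT X (@open 'cV[R]_n)) => //.
move=> _ [V oV <-]; rewrite setTI.
pose c (p : 'cV[rat]_n * rat) : set 'cV[R]_n :=
  [set y | forall i, `|ratr (p.1 i 0) - y i 0| < ratr p.2].
pose F (p : 'cV[rat]_n * rat) : set T :=
  if `[< c p `<=` V >] then X @^-1` c p else set0.
have -> : X @^-1` V = \bigcup_p F p.
  apply/seteqP; split => [w /= VXw|w [p _]]; last first.
    by rewrite /F; case: asboolP => // cV /cV.
  have : nbhs (X w) V by exact: open_nbhs_nbhs.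
  move=> /nbhs_ballP[e /= e0 eV].
  (* A rational r < e / 2: with a rational centre within r of X w, the box of radius r contains X w
     and stays within e of it. *)
  have [r] := rat_in_itvoo (divr_gt0 e0 (ltr0n R 2)).
  rewrite in_itv/= => /andP[r0 re].
  have /choice[q qP] : forall j, exists q : rat, `|ratr q - X w j 0| < ratr r.
    move=> j; have : X w j 0 < X w j 0 + ratr r by rewrite ltrDl.
    move=> /rat_in_itvoo[q]; rewrite in_itv/= => /andP[h1 h2].
    by exists q; rewrite ltr_distl; apply/andP; split; lra.
  exists (\col_j q j, r) => //; rewrite /F.
  have Xc : c (\col_j q j, r) (X w) by move=> i; rewrite mxE.
  rewrite asboolT//= => y cy; apply: eV; split=> // i j.
  rewrite (ord1 j) -ball_normE/=.
  have := cy i; rewrite mxE/= => h1; have h2 := qP i.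
  rewrite -(subrKA (ratr (q i))); apply: (le_lt_trans (ler_normD _ _)).
  by rewrite (distrC (X w i 0)); lra.
apply: countable_bigcupT_measurable => //= -[q r]; rewrite /F; case: ifP => // _.
rewrite (_ : X @^-1` c (q, r) =
    \bigcap_(i in [set: 'I_n]) [set w | `|ratr (q i 0) - X w i 0| < ratr r]).
  apply: fin_bigcap_measurable => // i _.
  rewrite -[X in measurable X]setTI.
  have mlt : measurable_fun setT (fun w => `|ratr (q i 0) - X w i 0| < ratr r).
    apply: measurable_fun_ltr => //.
    by apply: measurableT_comp => //; exact: measurable_funB.
  exact: (mlt measurableT [set true]).
by apply/seteqP; split => [w cw i _|w cw i]; [exact: cw|exact: (cw i I)].
Qed.

End ColumnMeasurability.

Section MatrixMeasurability.
Context d (T : measurableType d) (R : realType).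

Lemma measurable_det (k : nat) (A : T -> 'M[R]_k) :
  (forall i j, measurable_fun setT (fun w => A w i j)) ->
  measurable_fun setT (fun w => \det (A w)).
Proof.
move=> mA; rewrite /determinant; apply: measurable_sum => s.
apply: measurable_funM => //; apply: measurable_prod => i _; exact: mA.
Qed.

Lemma measurable_invmx (k : nat) (A : T -> 'M[R]_k) :
  (forall i j, measurable_fun setT (fun w => A w i j)) ->
  forall i j, measurable_fun setT (fun w => invmx (A w) i j).
Proof.
move=> mA i j.
(* [invmx] returns a singular matrix unchanged, hence the case split on the determinant; otherwise
   the entry is given by cofactors. *)
have -> : (fun w => invmx (A w) i j) = (fun w =>
   if \det (A w) == 0 then A w i j else
     (\det (A w))^-1 * cofactor (A w) j i).
  apply/funext => w; rewrite /invmx unitmxE unitfE.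
  by case: eqVneq => //= _; rewrite !mxE.
have md := measurable_det mA.
apply: measurable_fun_ifT => //.
  exact: measurable_fun_eqr.
apply: measurable_funM.
  exact: (measurableT_comp (@measurable_inv_real R) md).
rewrite /cofactor; apply: measurable_funM => //.
apply: measurable_det => i' j'.
rewrite (_ : (fun _ => _) = (fun w => A w (lift j i') (lift i j'))); first exact: mA.
by apply/funext => w; rewrite !mxE.
Qed.

Lemma measurable_mulmx_col (k : nat) (A : T -> 'M[R]_k) (v : T -> 'cV[R]_k) :
  (forall i j, measurable_fun setT (fun w => A w i j)) ->
  (forall j, measurable_fun setT (fun w => v w j 0)) ->
  forall i, measurable_fun setT (fun w => (A w *m v w) i 0).
Proof.
move=> mA mv i; under eq_fun do rewrite mxE.
by apply: measurable_sum => j; exact: measurable_funM.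
Qed.

Lemma measurable_dotv (k : nat) (u v : T -> 'cV[R]_k) :
  (forall j, measurable_fun setT (fun w => u w j 0)) ->
  (forall j, measurable_fun setT (fun w => v w j 0)) ->
  measurable_fun setT (fun w => dotv (u w) (v w)).
Proof.
move=> mu mv; rewrite /dotv; under eq_fun do rewrite mxE.
apply: measurable_sum => j; apply: measurable_funM => //.
by under eq_fun do rewrite mxE; exact: mu.
Qed.

End MatrixMeasurability.

(** * Independence and Fubini's theorem *)

Section ProductLaw.
Context d d1 d2 (T : measurableType d) (T1 : measurableType d1)
  (T2 : measurableType d2) (R : realType) (P : probability T R).
Context (X : {mfun T >-> T1}) (Y : {mfun T >-> T2}).
Context (indep : forall A B, measurable A -> measurable B ->
  (P (X @^-1` A `&` Y @^-1` B) = P (X @^-1` A) * P (Y @^-1` B))%E).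
Local Open Scope ereal_scope.

Let XY w := (X w, Y w).
Let mXY : measurable_fun setT XY.
Proof. by apply/measurable_fun_pair. Qed.
Let mXYmix := isMeasurableFun.Build _ _ _ _ _ mXY.
Let XYp : {mfun T >-> (T1 * T2)%type} := HB.pack XY mXYmix.

(** Independence is agreement of the two measures on rectangles, which determines the product
    measure. *)
Let joint_law (A : set (T1 * T2)) : measurable A ->
  (distribution P X \x distribution P Y) A = distribution P XYp A.
Proof.
by apply: product_measure_unique => B C mB mC; rewrite -indep.
Qed.

Lemma ge0_integral_indep (H : T1 * T2 -> \bar R) :
  measurable_fun setT H -> (forall z, 0 <= H z) ->
  \int[P]_w H (X w, Y w) = \int[P]_w \int[P]_w' H (X w, Y w').
Proof.
move=> mH H0.
transitivity (\int[distribution P XYp]_z H z).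
  by rewrite ge0_integral_distribution.
transitivity (\int[distribution P X \x distribution P Y]_z H z).
  by apply: eq_measure_integral => A mA _; exact/esym/joint_law.
rewrite fubini_tonelli1//.
rewrite ge0_integral_distribution//; first last.
- by move=> x; apply: integral_ge0.
- exact: measurable_fun_fubini_tonelli_F.
apply: eq_integral => w _ /=; rewrite /fubini_F.
rewrite ge0_integral_distribution//.
exact: measurableT_comp.
Qed.

Let integrable_joint (H : T1 * T2 -> \bar R) :
  measurable_fun setT H -> P.-integrable setT (fun w => H (X w, Y w)) ->
  (distribution P X \x distribution P Y).-integrable setT H.
Proof.
move=> mH iH.
have /integrableP[_ iHd] : (distribution P XYp).-integrable setT H.
  exact: integrable_pushforward.
apply/integrableP; split => //; apply: le_lt_trans iHd.
rewrite le_eqVlt; apply/orP; left; apply/eqP.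
by apply: eq_measure_integral => A mA _; exact: joint_law.
Qed.

Lemma integrable_indep (H : T1 * T2 -> \bar R) :
  measurable_fun setT H -> P.-integrable setT (fun w => H (X w, Y w)) ->
  P.-integrable setT (fun w => \int[distribution P Y]_y H (X w, y)).
Proof.
move=> mH iH.
have /integrableP[mF iF] := integrable_fubini_F (integrable_joint mH iH).
apply/integrableP; split; first exact: (measurableT_comp mF).
move: iF; rewrite ge0_integral_distribution//.
exact: measurableT_comp.
Qed.

(** The inner integral stays over the law of Y: pulling it back to P requires integrability of the
    section, which Fubini gives only for almost every w. *)
Lemma integral_indep (H : T1 * T2 -> \bar R) :
  measurable_fun setT H -> P.-integrable setT (fun w => H (X w, Y w)) ->
  \int[P]_w H (X w, Y w) =
    \int[P]_w \int[distribution P Y]_y H (X w, y).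
Proof.
move=> mH iH.
transitivity (\int[distribution P XYp]_z H z).
  by rewrite integral_distribution.
transitivity (\int[distribution P X \x distribution P Y]_z H z).
  by apply: eq_measure_integral => A mA _; exact/esym/joint_law.
rewrite -integral12_prod_meas1; last exact: integrable_joint.
rewrite integral_distribution//; last exact: integrable_indep.
exact: (measurable_fubini_F (integrable_joint mH iH)).
Qed.

End ProductLaw.

(** * Freezing the variables of a sub-sigma-algebra *)

Section SubSigmaAlgebra.
Context d du (T : measurableType d) (U : measurableType du) (R : realType)
  (P : probability T R).
Context (G : set (set T)) (Y : T -> U).
Context (sG : <<s G >> `<=` measurable) (mY : measurable_fun setT Y).
Context (indep : forall E A, <<s G >> E -> measurable A ->
  (P (E `&` Y @^-1` A) = P E * P (Y @^-1` A))%E).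
Local Open Scope ereal_scope.

(** The identity from T into T with the smaller sigma-algebra is a random variable independent of Y.
    Conditioning on [<<s G >>] thus becomes Fubini's theorem for the pair (id, Y), with no
    conditional expectation to construct. *)
Let TG := g_sigma_algebraType G.
Let idG : T -> TG := id.
Let midG : measurable_fun setT idG.
Proof. by move=> _ E mE; rewrite setTI; exact: sG. Qed.
Let idmix := isMeasurableFun.Build _ _ _ _ _ midG.
Let idp : {mfun T >-> TG} := HB.pack idG idmix.
Let Ymix := isMeasurableFun.Build _ _ _ _ _ mY.
Let Yp : {mfun T >-> U} := HB.pack Y Ymix.

Lemma ge0_integral_freeze (H : TG * U -> \bar R) :
  measurable_fun setT H -> (forall z, 0 <= H z) ->
  \int[P]_w H (w, Y w) = \int[P]_w \int[P]_w' H (w, Y w').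
Proof. exact: (@ge0_integral_indep _ _ _ _ _ _ _ P idp Yp indep). Qed.

Lemma measurable_integral_freeze (H : TG * U -> \bar R) :
  measurable_fun setT H -> (forall z, 0 <= H z) ->
  measurable_fun setT (fun w : T => \int[P]_w' H (w, Y w')).
Proof.
move=> mH H0.
have := @measurable_fun_fubini_tonelli_F _ _ _ _ _ (distribution P Yp) H mH H0.
move=> /measurableT_comp /(_ midG); apply: eq_measurable_fun => w _ /=.
rewrite /fubini_F ge0_integral_distribution//.
exact: measurableT_comp.
Qed.

Lemma integral_freeze_eq0 (H : TG * U -> \bar R) :
  measurable_fun setT H -> P.-integrable setT (fun w => H (w, Y w)) ->
  {ae P, forall w, P.-integrable setT (fun w' => H (w, Y w')) /\
     \int[P]_w' H (w, Y w') = 0} ->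
  \int[P]_w H (w, Y w) = 0.
Proof.
move=> mH iH H0.
rewrite (@integral_indep _ _ _ _ _ _ _ P idp Yp indep H mH iH).
rewrite -[RHS](integral0 P setT).
apply: ae_eq_integral => //.
  exact: measurable_int (@integrable_indep _ _ _ _ _ _ _ P idp Yp indep H mH iH).
move: H0; apply: (@filterS _ _ (ae_filter_ringOfSetsType P)) => w [iw w0] _.
rewrite -[RHS]w0 (integral_distribution (X := Yp))//.
exact: measurableT_comp.
Qed.

End SubSigmaAlgebra.

(** * Independence of one variable from the sigma-algebra of the others *)

Section Independence.
Context d du (T : measurableType d) (U : measurableType du) (R : realType)
  (P : probability T R) (I : choiceType) (D : set I) (X : I -> T -> U).
Context (mX : forall i, D i -> measurable_fun setT (X i)).

Lemma sigma_of_sub (D1 D2 : set I) : D1 `<=` D2 ->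
  sigma_of D1 X `<=` sigma_of D2 X.
Proof.
move=> D12; apply: sub_sigma_algebra2 => A [i Di XA]; exists i => //; exact: D12.
Qed.

Lemma sigma_of_measurable D1 : D1 `<=` D -> sigma_of D1 X `<=` measurable.
Proof.
move=> D1D; apply: smallest_sub; first exact: sigma_algebra_measurable.
by move=> _ [i D1i [B mB <-]]; apply: mX => //; exact: D1D.
Qed.

Lemma sigma_of_preimage D1 i A : D1 i -> measurable A ->
  sigma_of D1 X (X i @^-1` A).
Proof.
move=> Di mA; apply: sub_sigma_algebra; exists i => //.
by exists A => //; rewrite setTI.
Qed.

Context (indep : mutually_independent P D X).

(** A pi-system argument: finite intersections of preimages of variables other than X_p are stable
    under intersection and generate the sigma-algebra, and on them the product formula is mutual
    independence. *)
Lemma sigma_of_indep p E A : D p -> sigma_of (D `\ p) X E -> measurable A ->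
  (P (E `&` X p @^-1` A) = P E * P (X p @^-1` A))%E.
Proof.
move=> Dp DE mA.
have mXA i B : D i -> measurable B -> measurable (X i @^-1` B).
  by move=> Di mB; rewrite -[X in measurable X]setTI; exact: mX.
pose G : set (set T) := [set E | exists (J : {fset I}) (B : I -> set U),
  [/\ [set` J] `<=` D `\ p, forall i, measurable (B i)
    & E = \bigcap_(i in [set` J]) (X i @^-1` B i)]].
have GI : setI_closed G.
  move=> _ _ [J1 [B1 [J1D mB1 ->]]] [J2 [B2 [J2D mB2 ->]]].
  exists (J1 `|` J2)%fset.
  (* An index missing from one of the families imposes no condition there, so its set is taken to be
     the whole space. *)
  exists (fun i => (if i \in J1 then B1 i else setT) `&`
                   (if i \in J2 then B2 i else setT)).
  split.
  - by move=> i /=; rewrite in_fsetU => /orP[iJ|iJ]; [exact: J1D|exact: J2D].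
  - by move=> i; apply: measurableI; case: ifP.
  - apply/seteqP; split => [w [w1 w2] i _ /=|w w12].
      by split; case: ifP => // iJ; [exact: w1|exact: w2].
    split=> i /= iJ.
      by have := w12 i; rewrite /= in_fsetU iJ => /(_ isT)[].
    by have := w12 i; rewrite /= in_fsetU iJ orbT => /(_ isT)[].
have Gm : G `<=` measurable.
  move=> _ [J [B [JD mB ->]]]; apply: fin_bigcap_measurable => // i /= iJ.
  by apply: mXA => //; case: (JD i iJ).
have GE : <<s G >> E.
  apply: sub_sigma_algebra2 DE => _ [i Di [B mB <-]].
  exists [fset i]%fset, (fun=> B); split => //.
    by move=> j /=; rewrite in_fset1 => /eqP ->.
  apply/seteqP; split => [w [_ Bw] j /=|w wB].
    by rewrite in_fset1 => /eqP ->.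
  by split=> //; apply: (wB i); rewrite /= in_fset1.
have PA : (0 <= fine (P (X p @^-1` A)))%R by apply: fine_ge0.
have mXpA := mXA p A Dp mA.
(* Both sides are now read as finite measures of E: P restricted to the event X_p in A, and P scaled
   by the probability of that event. *)
rewrite muleC -[P (X p @^-1` A)]fineK ?fin_num_measure//.
apply: (g_sigma_algebra_measure_unique G Gm (fun=> setT) _ _
  (mrestr P mXpA) (mscale (NngNum PA) P)) => //.
- by move=> _; exists fset0, (fun=> setT); split => //; rewrite set_fset0 bigcap_set0.
- by rewrite bigcup_const//.
- move=> _ [J [B [JD mB ->]]]; rewrite /mrestr/= /mscale/= fineK ?fin_num_measure//.
  have pJ : p \notin J by apply/negP => /JD[_ /(_ erefl)].
  (* Mutual independence is used twice, for J enlarged by p with A at p, and for J alone. *)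
  pose B' i := if i == p then A else B i.
  have BB' i : i \in J -> B' i = B i.
    by rewrite /B'; case: eqVneq => // ->; rewrite (negbTE pJ).
  have mB' i : measurable (B' i) by rewrite /B'; case: ifP.
  have pJD : [set` (p |` J)%fset] `<=` D.
    by move=> i /=; rewrite in_fset1U => /orP[/eqP ->//|/JD[]].
  have := indep pJD (fun i _ => mB' i).
  rewrite bigcap_fsetU1 (big_fsetU1 _ _ pJ)/=.
  have -> : B' p = A by rewrite /B' eqxx.
  have -> : \bigcap_(i in [set` J]) X i @^-1` B' i =
            \bigcap_(i in [set` J]) X i @^-1` B i.
    by apply: eq_bigcapr => i /= iJ; rewrite BB'.
  rewrite setIC => PE; apply: (etrans PE); congr (_ * _)%E.
  rewrite indep//; last by move=> i /JD[].
  by apply: eq_big_seq => i iJ; rewrite BB'.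
- move=> _; rewrite /= /mrestr setTI.
  by apply: (le_lt_trans (probability_le1 _ _)) => //; exact: ltry.
Qed.

End Independence.

(** * Expectations of real functions *)

Section RealExpectation.
Context d (T : measurableType d) (R : realType) (P : probability T R).
Implicit Types u v g : T -> R.

Definition intble u := P.-integrable setT (EFin \o u).

Lemma intble_measurable u : intble u -> measurable_fun setT u.
Proof. by move=> /measurable_int/measurable_EFinP. Qed.

Lemma intble_cst (c : R) : intble (cst c).
Proof. exact: finite_measure_integrable_cst. Qed.

Lemma intbleD u v : intble u -> intble v -> intble (fun w => u w + v w).
Proof. by move=> iu iv; exact: (integrableD measurableT iu iv). Qed.

Lemma intbleZ (c : R) u : intble u -> intble (fun w => c * u w).
Proof. by move=> iu; exact: (integrableZl measurableT c iu). Qed.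

Lemma intble_sum (I : Type) (s : seq I) (u : I -> T -> R) :
  (forall i, intble (u i)) -> intble (fun w => \sum_(i <- s) u i w).
Proof.
move=> iu; elim: s => [|i s IHs].
  by under eq_fun do rewrite big_nil; exact: intble_cst.
by under eq_fun do rewrite big_cons; exact: intbleD.
Qed.

Lemma RintbleD u v : intble u -> intble v ->
  \int[P]_w (u w + v w) = \int[P]_w u w + \int[P]_w v w.
Proof. by move=> iu iv; rewrite RintegralD. Qed.

Lemma RintbleZ (c : R) u : intble u -> \int[P]_w (c * u w) = c * \int[P]_w u w.
Proof. by move=> iu; rewrite RintegralZl. Qed.

Lemma Rintble_cst (c : R) : \int[P]_w c = c.
Proof.
by rewrite Rintegral_cst// /= probability_setT mulr1.
Qed.

Lemma Rintble_sum (I : Type) (s : seq I) (u : I -> T -> R) :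
  (forall i, intble (u i)) ->
  \int[P]_w (\sum_(i <- s) u i w) = \sum_(i <- s) \int[P]_w u i w.
Proof.
move=> iu; elim: s => [|i s IHs].
  by under eq_Rintegral do rewrite big_nil; rewrite Rintble_cst big_nil.
under eq_Rintegral do rewrite big_cons.
by rewrite RintbleD ?big_cons ?IHs//; exact: intble_sum.
Qed.

Lemma EFin_Rintble u : intble u -> (\int[P]_w u w)%:E = (\int[P]_w (u w)%:E)%E.
Proof. by move=> iu; rewrite /Rintegral fineK//; exact: integrable_fin_num. Qed.

Lemma ae_dominated_intble u g : measurable_fun setT u -> intble g ->
  {ae P, forall w, `|u w| <= g w} -> intble u.
Proof.
move=> mu /integrableP[mg ig] ug; apply/integrableP; split.
  exact/measurable_EFinP.
apply: le_lt_trans ig; apply: ae_ge0_le_integral => //.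
- exact/measurableT_comp/measurable_EFinP.
- exact: measurableT_comp.
move: ug; apply: (@filterS _ _ (ae_filter_ringOfSetsType P)) => w ug _.
by rewrite /= lee_fin (le_trans ug)// ler_norm.
Qed.

(** Monotonicity of the integral is applied pointwise, so u is first replaced by min(u, v), which
    equals u almost everywhere. *)
Lemma ae_le_Rintble u v : intble u -> intble v ->
  {ae P, forall w, u w <= v w} -> \int[P]_w u w <= \int[P]_w v w.
Proof.
move=> iu iv uv.
have mmin : measurable_fun setT (fun w => Num.min (u w) (v w)).
  by apply: measurable_minr; exact: intble_measurable.
have ae_min : {ae P, forall w, Num.min (u w) (v w) = u w}.
  move: uv; apply: (@filterS _ _ (ae_filter_ringOfSetsType P)) => w uv.
  exact: min_l.
have imin : intble (fun w => Num.min (u w) (v w)).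
  apply: (ae_dominated_intble (g := fun w => `|u w|) mmin); first exact: integrable_norm.
  move: ae_min; apply: (@filterS _ _ (ae_filter_ringOfSetsType P)) => w ->.
  exact: lexx.
suff -> : \int[P]_w u w = \int[P]_w Num.min (u w) (v w).
  by apply: le_Rintegral => // w _; rewrite ge_min lexx orbT.
congr fine; apply: ae_eq_integral => //.
- exact: measurable_int iu.
- exact: measurable_int imin.
move: ae_min; apply: (@filterS _ _ (ae_filter_ringOfSetsType P)) => w /= -> _ //.
Qed.

Definition sqintble u := measurable_fun setT u /\ intble (fun w => u w ^+ 2).

Lemma sqintbleM u v : sqintble u -> sqintble v -> intble (fun w => u w * v w).
Proof.
move=> [mu iu] [mv iv].
apply: (ae_dominated_intble _ (intbleD iu iv)).
  exact: measurable_funM.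
(* Expanding (|u| - |v|)^2 >= 0 bounds |u v| by u^2 + v^2. *)
apply: aeW => w; have := sqr_ge0 (`|u w| - `|v w|).
rewrite normrM -[u w ^+ 2]real_normK ?num_real// -[v w ^+ 2]real_normK ?num_real//.
rewrite sqrrB; have := mulr_ge0 (normr_ge0 (u w)) (normr_ge0 (v w)).
by rewrite -mulr_natr; lra.
Qed.

Lemma sqintble_cst (c : R) : sqintble (cst c).
Proof. by split => //; exact: (intble_cst (c ^+ 2)). Qed.

Lemma sqintble_intble u : sqintble u -> intble u.
Proof.
move=> su; have := sqintbleM su (sqintble_cst 1).
by under eq_fun do rewrite mulr1.
Qed.

Lemma sqintbleZ (c : R) u : sqintble u -> sqintble (fun w => c * u w).
Proof.
move=> [mu iu]; split; first exact: measurable_funM.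
by under eq_fun do rewrite exprMn; exact: intbleZ.
Qed.

Lemma sqintbleD u v : sqintble u -> sqintble v -> sqintble (fun w => u w + v w).
Proof.
move=> su sv; have [[mu iu] [mv iv]] := (su, sv).
split; first exact: measurable_funD.
under eq_fun do rewrite sqrrD -mulr_natl.
apply: intbleD => //; apply: intbleD => //; apply: intbleZ; exact: sqintbleM.
Qed.

Lemma ae_dominated_sqintble u g : measurable_fun setT u -> intble g ->
  {ae P, forall w, u w ^+ 2 <= g w} -> sqintble u.
Proof.
move=> mu ig ug; split => //.
apply: (ae_dominated_intble _ ig); first exact: measurable_funX.
move: ug; apply: (@filterS _ _ (ae_filter_ringOfSetsType P)) => w.
by rewrite ger0_norm ?sqr_ge0.
Qed.

End RealExpectation.

(** * The error of one oracle call *)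

Section Noise.
Context d (T : measurableType d) (R : realType) (P : probability T R) (n q : nat).
Context (G : 'cV[R]_n -> 'cV[R]_q -> 'cV[R]_n) (a : 'cV[R]_n -> 'cV[R]_n).
Context (F : set (set T)) (X : T -> 'cV[R]_n) (Y : T -> 'cV[R]_q) (sigma : R).
Context (G_meas : measurable_fun setT
  (fun p : borel_cV R n * borel_cV R q => G p.1 p.2 : borel_cV R n)).
Context (a_cont : continuous a).
Context (sF : <<s F >> `<=` measurable).
Context (mY : measurable_fun setT (Y : T -> borel_cV R q)).
Context (indep : forall (E : set T) (A : set (borel_cV R q)), <<s F >> E -> measurable A ->
  (P (E `&` Y @^-1` A) = P E * P (Y @^-1` A))%E).
Let TF := g_sigma_algebraType F.
Context (mX : measurable_fun setT (X : TF -> borel_cV R n)).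
Context (unbiased : {ae P, forall w, forall j,
  ('E_P[(fun w' => G (X w) (Y w') j 0)%R] = (a (X w) j 0)%R%:E)%E}).
Context (variance : {ae P, forall w,
  ('E_P[(fun w' => norm2 (G (X w) (Y w') - a (X w)) ^+ 2)%R] <= (sigma ^+ 2)%R%:E)%E}).

(** The outcome fixing the iterate and the sample value are separate arguments, so that one can be
    frozen while the other is integrated. *)
Let e (w : T) (z : 'cV[R]_q) : 'cV[R]_n := G (X w) z - a (X w).

Lemma measurable_continuous_col (Z : TF -> 'cV[R]_n) j :
  measurable_fun setT (Z : TF -> borel_cV R n) ->
  measurable_fun setT (fun w : TF => a (Z w) j 0).
Proof.
move=> mZ; have mc : measurable_fun setT ((fun x => a x j 0) : borel_cV R n -> R).
  apply: continuous_borel_cV => x.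
  apply: (@continuous_comp _ _ _ a (fun y : 'cV[R]_n => y j 0)).
    exact: a_cont.
  exact: coord_continuous.
exact: (measurableT_comp mc mZ).
Qed.

Let me_joint j : measurable_fun setT (fun p : TF * borel_cV R q => e p.1 p.2 j 0).
Proof.
under eq_fun do rewrite /e mxE [X in _ + X]mxE.
apply: measurable_funB; last first.
  exact: (measurableT_comp (measurable_continuous_col j mX) measurable_fst).
apply: measurable_coord.
have mp : measurable_fun setT (fun p : TF * borel_cV R q => (X p.1 : borel_cV R n, p.2)).
  apply: measurable_fun_pair; last exact: measurable_snd.
  exact: (measurableT_comp mX measurable_fst).
exact: (measurableT_comp G_meas mp).
Qed.

Let idF : T -> TF := id.
Let midF : measurable_fun setT idF.
Proof. by move=> _ E mE; rewrite setTI; exact: sF. Qed.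

Let mpairY : measurable_fun setT (fun w : T => (idF w, Y w : borel_cV R q)).
Proof. exact: measurable_fun_pair. Qed.

Lemma measurable_noise j : measurable_fun setT (fun w => e w (Y w) j 0).
Proof. exact: (measurableT_comp (me_joint j) mpairY). Qed.

Let sq (p : TF * borel_cV R q) : \bar R := (dotv (e p.1 p.2) (e p.1 p.2))%:E.
Let msq : measurable_fun setT sq.
Proof. by apply/measurable_EFinP; apply: measurable_dotv; exact: me_joint. Qed.
Let sq_ge0 p : (0 <= sq p)%E.
Proof. by rewrite lee_fin dotvv_ge0. Qed.

(** After freezing w, the inner integral over the sample is the variance at a fixed iterate, at most
    sigma^2 for almost every w. *)
Let integral_noise_sqnorm :
  (\int[P]_w (dotv (e w (Y w)) (e w (Y w)))%:E <= (sigma ^+ 2)%:E)%E.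
Proof.
rewrite (ge0_integral_freeze sF mY indep msq sq_ge0).
have -> : (sigma ^+ 2)%:E = (\int[P]_w (cst (sigma ^+ 2)%:E w))%E.
  by rewrite integral_cst//= probability_setT mule1.
apply: ae_ge0_le_integral => //.
- by move=> w _; apply: integral_ge0.
- exact: (measurable_integral_freeze P sF mY msq sq_ge0).
- by move=> w _; rewrite lee_fin sqr_ge0.
move: variance; apply: (@filterS _ _ (ae_filter_ringOfSetsType P)) => w + _.
rewrite unlock; apply: le_trans; rewrite le_eqVlt; apply/orP; left; apply/eqP.
by apply: eq_integral => w' _; rewrite /sq /= norm2_sq.
Qed.

Lemma intble_noise_sqnorm : intble P (fun w => dotv (e w (Y w)) (e w (Y w))).
Proof.
apply/integrableP; split.
  by apply/measurable_EFinP; apply: measurable_dotv; exact: measurable_noise.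
under eq_integral do rewrite /= ger0_norm ?dotvv_ge0//.
exact: le_lt_trans integral_noise_sqnorm (ltry _).
Qed.

Lemma expect_noise_sqnorm : \int[P]_w dotv (e w (Y w)) (e w (Y w)) <= sigma ^+ 2.
Proof.
by rewrite -lee_fin EFin_Rintble//; exact: intble_noise_sqnorm.
Qed.

Lemma sqintble_noise j : sqintble P (fun w => e w (Y w) j 0).
Proof.
apply: ae_dominated_sqintble intble_noise_sqnorm _; first exact: measurable_noise.
by apply: aeW => w; exact: sqr_coord_le.
Qed.

(** With w frozen, v is a constant factor and the remaining inner integral is the mean error of the
    oracle at a fixed iterate, which is 0 by unbiasedness. *)
Lemma noise_orthogonal (v : TF -> R) j :
  measurable_fun setT v -> sqintble P v ->
  \int[P]_w (v w * e w (Y w) j 0) = 0.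
Proof.
move=> mv sv.
pose H (p : TF * borel_cV R q) : \bar R := (v p.1 * e p.1 p.2 j 0)%:E.
have mH : measurable_fun setT H.
  apply/measurable_EFinP; apply: measurable_funM; last exact: me_joint.
  exact: (measurableT_comp mv measurable_fst).
rewrite /Rintegral (_ : (\int[P]_w _)%E = 0%E)//.
apply: (integral_freeze_eq0 sF mY indep mH).
  exact: (sqintbleM sv (sqintble_noise j)).
move: unbiased variance; apply: (@filterS2 _ _ (ae_filter_ringOfSetsType P)) => w unb var.
have mew i : measurable_fun setT (fun w' => e w (Y w') i 0).
  have h := measurableT_comp (me_joint i) (pair1_measurable (w : TF)).
  exact: (measurableT_comp h mY).
have isq : intble P (fun w' => dotv (e w (Y w')) (e w (Y w'))).
  apply/integrableP; split.
    by apply/measurable_EFinP; apply: measurable_dotv.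
  apply: le_lt_trans (ltry (sigma ^+ 2)); move: var; rewrite unlock; apply: le_trans.
  rewrite le_eqVlt; apply/orP; left; apply/eqP; apply: eq_integral => w' _.
  by rewrite /= norm2_sq ger0_norm ?dotvv_ge0.
have ie : intble P (fun w' => e w (Y w') j 0).
  apply: sqintble_intble; apply: ae_dominated_sqintble isq _ => //.
  by apply: aeW => w'; exact: sqr_coord_le.
split; first exact: (intbleZ (v w) ie).
rewrite /H /= -EFin_Rintble; last exact: intbleZ.
rewrite RintbleZ//.
have -> : \int[P]_w' e w (Y w') j 0 = 0; last by rewrite mulr0.
apply/EFin_inj; rewrite EFin_Rintble//.
(* Adding back the constant gradient makes the oracle value itself integrable, so the integral of
   the difference may be split. *)
have iG : intble P (fun w' => G (X w) (Y w') j 0).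
  have := intbleD ie (intble_cst P (a (X w) j 0)).
  by apply: eq_integrable => // w' _; rewrite /= /e !mxE subrK.
have -> : (\int[P]_w' (e w (Y w') j 0)%:E =
    \int[P]_w' ((G (X w) (Y w') j 0)%:E - (a (X w) j 0)%:E))%E.
  by apply: eq_integral => w' _; rewrite /e !mxE EFinB.
rewrite integralB//; last exact: (intble_cst P).
have := unb j; rewrite unlock => ->.
by rewrite integral_cst//= probability_setT mule1 subee.
Qed.

Lemma noise_orthogonal_vec (u : TF -> 'cV[R]_n) :
  (forall j, measurable_fun setT (fun w => u w j 0)) ->
  (forall j, sqintble P (fun w => u w j 0)) ->
  intble P (fun w => dotv (u w) (e w (Y w))) /\
  \int[P]_w dotv (u w) (e w (Y w)) = 0.
Proof.
move=> mu su.
have iM j : intble P (fun w => u w j 0 * e w (Y w) j 0).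
  by apply: sqintbleM => //; exact: sqintble_noise.
split.
  by under eq_fun do rewrite dotvE; exact: intble_sum.
under eq_Rintegral do rewrite dotvE.
by rewrite Rintble_sum// big1// => j _; exact: noise_orthogonal.
Qed.

End Noise.

(** * Runs of the algorithm *)

Section Run.
Context {R : realType} {n q : nat}.
Context (G : 'cV[R]_n -> 'cV[R]_q -> 'cV[R]_n).
Context {dT : measure_display} {T : measurableType dT} (P : probability T R).
Context (f : 'cV[R]_n -> R) (flow L : R) (Xi : set 'cV[R]_q) (sigma m M delta : R)
    (x1 : 'cV[R]_n) (B1 : 'M[R]_n) (N : nat) (b : nat -> nat)
    (alpha pmf zeta : nat -> R) (xi : nat -> nat -> T -> 'cV[R]_q)
    (tau : T -> nat) (x : nat -> T -> 'cV[R]_n) (B : nat -> T -> 'M[R]_n).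
Context (L_gt0 : 0 < L) (f_smooth : smooth_objective f flow L).
Context (G_meas : measurable_fun setT
  (fun p : borel_cV R n * borel_cV R q => G p.1 p.2 : borel_cV R n)).
Context (m_gt0 : 0 < m) (M_gt0 : 0 < M) (b_gt0 : forall k, (0 < b k)%N).
Context (run :
  rsqn_run G P f Xi sigma m M delta x1 B1 N b alpha pmf zeta xi tau x B).

Let D := sample_index b N.
Let Z (p : nat * nat) : T -> borel_cV R q := xi p.1 p.2.
Let gen (D1 : set (nat * nat)) : set (set T) :=
  \bigcup_(p in D1) preimage_set_system setT (Z p) measurable.
(** T with only the information in the samples indexed by D1. For D1 = [sample_index b k.-1] this is
    the history before iteration k, and measurability in it expresses dependence on earlier samples
    only. *)
Let TG (D1 : set (nat * nat)) := g_sigma_algebraType (gen D1).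

Let mZ p : D p -> measurable_fun setT (Z p).
Proof. by case: p => k i Dp; exact: (run_sample_meas run Dp). Qed.

Let gen_measurable D1 : D1 `<=` D -> <<s gen D1 >> `<=` measurable.
Proof. by move=> D1D; exact: (sigma_of_measurable mZ D1D). Qed.

Let measurable_mono du (U : measurableType du) (u : T -> U) D1 D2 : D1 `<=` D2 ->
  measurable_fun setT (u : TG D1 -> U) -> measurable_fun setT (u : TG D2 -> U).
Proof.
move=> D12 mu _ A mA; apply: (sigma_of_sub D12); exact: mu.
Qed.

Let measurable_T (u : T -> R) D1 : D1 `<=` D ->
  measurable_fun setT (u : TG D1 -> R) -> measurable_fun setT u.
Proof. move=> D1D mu _ A mA; apply: (gen_measurable D1D); exact: mu. Qed.

Let measurable_Z D1 p : D1 p -> measurable_fun setT (Z p : TG D1 -> borel_cV R q).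
Proof. by move=> Dp _ A mA; rewrite setTI; exact: sigma_of_preimage. Qed.

Let index_mono k l : (k <= l)%N -> sample_index b k `<=` sample_index b l.
Proof. by move=> kl p [/andP[p1 pk] pb]; split=> //; rewrite p1 (leq_trans pk). Qed.

(** [run_adapted] speaks of k >= 2; for k = 1 the matrix is constant, hence measurable even with no
    samples. *)
Let B_measurable k i j : (1 <= k <= N)%N ->
  measurable_fun setT ((fun w => B k w i j) : TG (sample_index b k.-1) -> R).
Proof.
move=> /andP[k1 kN]; have [k2|] := ltnP 1 k.
  move=> _ A mA; rewrite setTI.
  by apply: (run_adapted run _ i j mA); rewrite k2 kN.
case: k k1 kN => [|[|]]// _ _ _.
rewrite (_ : (fun w => B 1 w i j) = cst (B1 i j))//.
by apply/funext => w; rewrite (run_B1 run).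
Qed.

Let hessian k w := invmx (B k w) + (zeta k)%:M.

Let hessian_measurable k i j : (1 <= k <= N)%N ->
  measurable_fun setT ((fun w => hessian k w i j) : TG (sample_index b k.-1) -> R).
Proof.
move=> kN; under eq_fun do rewrite mxE.
by apply: measurable_funD => //; apply: measurable_invmx => i' j'; exact: B_measurable.
Qed.

Let sample_measurable D1 k i j :
  measurable_fun setT (x k : TG D1 -> borel_cV R n) -> D1 (k, i) ->
  measurable_fun setT ((fun w => G (x k w) (xi k i w) j 0) : TG D1 -> R).
Proof.
move=> mx Dki; apply: measurable_coord.
have mp : measurable_fun setT
    ((fun w => (x k w, Z (k, i) w)) : TG D1 -> borel_cV R n * borel_cV R q).
  by apply: measurable_fun_pair => //; exact: measurable_Z.
exact: (measurableT_comp G_meas mp).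
Qed.

(** Induction along the recursion: the step from x_k to x_(k+1) adds only the samples of iteration
    k. The range includes N + 1, where the telescoping ends. *)
Let iterate_measurable k : (1 <= k <= N.+1)%N ->
  measurable_fun setT (x k : TG (sample_index b k.-1) -> borel_cV R n).
Proof.
elim: k => [//|k IHk] kN; case: k => [|k] in IHk kN *.
  by rewrite (_ : x 1 = cst x1)//; apply/funext => w; exact: (run_x1 run).
have {}IHk := IHk (ltnW kN).
have kN' : (1 <= k.+1 <= N)%N by [].
rewrite (_ : x k.+2 = fun w => x k.+1 w - alpha k.+1 *:
    (hessian k.+1 w *m batch_mean G (b k.+1) (x k.+1 w) (fun i => xi k.+1 i w))); last first.
  by apply/funext => w; exact: (run_step run).
have sub : sample_index b k.+1.-1 `<=` sample_index b k.+2.-1 by exact: index_mono.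
have mx := measurable_mono sub IHk.
apply: measurable_colP => j.
under eq_fun do rewrite mxE [X in _ + X]mxE [X in - X]mxE.
apply: measurable_funB; first exact: measurable_coord.
apply: measurable_funM => //.
apply: measurable_mulmx_col => [i' j'|j'].
  by apply: (measurable_mono sub); exact: hessian_measurable.
under eq_fun do rewrite mxE summxE.
apply: measurable_funM => //; apply: measurable_sum => i.
by apply: sample_measurable => //; split => //=; rewrite leqnn.
Qed.

Let grad_continuous : continuous (grad f).
Proof. by have [] := f_smooth. Qed.

Let a k w := grad f (x k w).

Let grad_measurable k j : (1 <= k <= N.+1)%N ->
  measurable_fun setT ((fun w => a k w j 0) : TG (sample_index b k.-1) -> R).
Proof.
by move=> kN; apply: (measurable_continuous_col grad_continuous); exact: iterate_measurable.
Qed.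

Let noise k i w := G (x k w) (xi k i w) - a k w.

Let noise_measurable D1 k i j : (1 <= k <= N)%N ->
  sample_index b k.-1 `<=` D1 -> D1 (k, i) ->
  measurable_fun setT ((fun w => noise k i w j 0) : TG D1 -> R).
Proof.
move=> kN sub Dki; have /andP[k1 kN'] := kN.
have kN1 : (1 <= k <= N.+1)%N by rewrite k1 ltnW.
under eq_fun do rewrite mxE [X in _ + X]mxE.
apply: measurable_funB; last by apply: (measurable_mono sub); exact: grad_measurable.
by apply: sample_measurable => //; apply: (measurable_mono sub); exact: iterate_measurable.
Qed.

(** * One iteration: the batch error and the expected decrease *)

Section Iteration.
Context (k : nat).
Context (kN : (1 <= k <= N)%N).

Let kN1 : (1 <= k <= N.+1)%N.
Proof. by case/andP: kN => -> /leqW ->. Qed.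

(** The samples other than (k, i) contain both the history before iteration k and the rest of its
    batch. Against all of these the sample (k, i) is independent. *)
Let past_sub i : sample_index b k.-1 `<=` D `\ (k, i).
Proof.
move=> p [/andP[p1 pk] pb]; case/andP: kN => k1 kleN; split.
  by split => //; rewrite p1 (leq_trans pk)// (leq_trans (leq_pred _)).
by move=> /= pE; move: pk; rewrite pE /= leqNgt prednK// leqnn.
Qed.

Let past_subD : sample_index b k.-1 `<=` D.
Proof. by move=> p /(past_sub 0)[]. Qed.

Let indexD i : (i < b k)%N -> D (k, i).
Proof. by move=> ib; split. Qed.

Let subD i : D `\ (k, i) `<=` D.
Proof. by move=> p []. Qed.

Let xi_indep i : (i < b k)%N -> forall (E : set T) (A : set (borel_cV R q)),
  <<s gen (D `\ (k, i)) >> E -> measurable A ->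
  (P (E `&` xi k i @^-1` A) = P E * P (xi k i @^-1` A))%E.
Proof.
move=> ib E A EF mA.
exact: (sigma_of_indep mZ (run_sample_indep run) (indexD ib) EF mA).
Qed.

Let mxi i : (i < b k)%N -> measurable_fun setT (xi k i : T -> borel_cV R q).
Proof. by move=> /indexD; exact: (run_sample_meas run). Qed.

Let mxk i : measurable_fun setT (x k : TG (D `\ (k, i)) -> borel_cV R n).
Proof. by apply: (measurable_mono (@past_sub i)); exact: iterate_measurable. Qed.

Let intble_sqnorm i : (i < b k)%N -> intble P (fun w => dotv (noise k i w) (noise k i w)).
Proof.
move=> ib; exact: (intble_noise_sqnorm G_meas grad_continuous
  (gen_measurable (@subD i)) (mxi ib) (xi_indep ib) (@mxk i) (run_variance run (indexD ib))).
Qed.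

Let expect_sqnorm i : (i < b k)%N ->
  \int[P]_w dotv (noise k i w) (noise k i w) <= sigma ^+ 2.
Proof.
move=> ib; exact: (expect_noise_sqnorm G_meas grad_continuous
  (gen_measurable (@subD i)) (mxi ib) (xi_indep ib) (@mxk i) (run_variance run (indexD ib))).
Qed.

Let sqintble_coord i j : (i < b k)%N -> sqintble P (fun w => noise k i w j 0).
Proof.
move=> ib; exact: (sqintble_noise G_meas grad_continuous
  (gen_measurable (@subD i)) (mxi ib) (xi_indep ib) (@mxk i) (run_variance run (indexD ib))).
Qed.

(** The vector u may depend on the other samples of the same batch. This serves both the cross terms
    inside the batch and the pairing with [drift]. *)
Let orthogonal i (u : T -> 'cV[R]_n) : (i < b k)%N ->
  (forall j, measurable_fun setT ((fun w => u w j 0) : TG (D `\ (k, i)) -> R)) ->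
  (forall j, sqintble P (fun w => u w j 0)) ->
  intble P (fun w => dotv (u w) (noise k i w)) /\
  \int[P]_w dotv (u w) (noise k i w) = 0.
Proof.
move=> ib; exact: (noise_orthogonal_vec G_meas grad_continuous
  (gen_measurable (@subD i)) (mxi ib) (xi_indep ib) (@mxk i)
  (run_unbiased run (indexD ib)) (run_variance run (indexD ib))).
Qed.

Let total r w := \sum_(i < r) noise k i w.

Let sqintble_total r j : (r <= b k)%N -> sqintble P (fun w => total r w j 0).
Proof.
move=> rb; elim: r rb => [|r IHr] rb.
  under eq_fun do rewrite /total big_ord0 mxE; exact: sqintble_cst.
under eq_fun do rewrite /total big_ord_recr mxE.
by apply: sqintbleD; [exact: IHr (ltnW rb)|exact: sqintble_coord].
Qed.

(* The partial sum is measurable with respect to the samples other than (k, r),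
   so its cross term with the next noise vanishes. *)
Let total_sqnorm r : (r <= b k)%N ->
  intble P (fun w => dotv (total r w) (total r w)) /\
  \int[P]_w dotv (total r w) (total r w) <= r%:R * sigma ^+ 2.
Proof.
elim: r => [|r IHr] rb.
  have z w : dotv (total 0 w) (total 0 w) = 0 by rewrite /total big_ord0 /dotv mulmx0 mxE.
  split; first by under eq_fun do rewrite z; exact: intble_cst.
  by under eq_Rintegral do rewrite z; rewrite Rintble_cst mul0r.
have [ir er] := IHr (ltnW rb).
have [ic ec] : intble P (fun w => dotv (total r w) (noise k r w)) /\
    \int[P]_w dotv (total r w) (noise k r w) = 0.
  apply: orthogonal => // j; last exact/sqintble_total/ltnW.
  under eq_fun do rewrite /total summxE.
  apply: measurable_sum => i; apply: noise_measurable => //.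
  split; first by apply: indexD; rewrite (ltn_trans (ltn_ord i)).
  by move=> /= [ir']; move: (ltn_ord i); rewrite ir' ltnn.
have tE w : dotv (total r.+1 w) (total r.+1 w) =
    dotv (total r w) (total r w) + (2 * dotv (total r w) (noise k r w) +
      dotv (noise k r w) (noise k r w)).
  by rewrite /total big_ord_recr/= dotvvD addrA.
have i2 := intbleZ 2 ic; have i3 := intble_sqnorm rb.
have i23 := intbleD i2 i3.
split; first by under eq_fun do rewrite tE; exact: intbleD.
under eq_Rintegral do rewrite tE.
rewrite RintbleD// RintbleD// RintbleZ// ec mulr0 add0r -natr1 mulrDl mul1r.
by apply: lerD => //; exact: expect_sqnorm.
Qed.

Let err w := (b k)%:R^-1 *: total (b k) w.

Let bR_gt0 : 0 < (b k)%:R :> R. Proof. by rewrite ltr0n. Qed.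

Let batch_mean_err w :
  batch_mean G (b k) (x k w) (fun i => xi k i w) = a k w + err w.
Proof.
have aE : (b k)%:R^-1 *: (a k w *+ b k) = a k w.
  by rewrite -[X in _ *: X]scaler_nat scalerA mulVf ?lt0r_neq0// scale1r.
by rewrite /err /total /noise sumrB sumr_const card_ord scalerBr aE addrC subrK.
Qed.

Let intble_err : intble P (fun w => dotv (err w) (err w)).
Proof.
by under eq_fun do rewrite dotvvZ; apply: intbleZ; have [] := total_sqnorm (leqnn (b k)).
Qed.

Let expect_err : \int[P]_w dotv (err w) (err w) <= sigma ^+ 2 / (b k)%:R.
Proof.
have [it et] := total_sqnorm (leqnn (b k)).
under eq_Rintegral do rewrite dotvvZ.
rewrite RintbleZ// exprVn mulrC ler_pdivrMr ?exprn_gt0//.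
by rewrite expr2 mulrA divfK ?lt0r_neq0// mulrC.
Qed.

Let err_orthogonal (c : T -> 'cV[R]_n) :
  (forall j, measurable_fun setT ((fun w => c w j 0) : TG (sample_index b k.-1) -> R)) ->
  (forall j, sqintble P (fun w => c w j 0)) ->
  intble P (fun w => dotv (c w) (err w)) /\ \int[P]_w dotv (c w) (err w) = 0.
Proof.
move=> mc sc.
have o (i : 'I_(b k)) := orthogonal (ltn_ord i)
  (fun j => measurable_mono (@past_sub i) (mc j)) sc.
have dE w : dotv (c w) (err w) = (b k)%:R^-1 * \sum_(i < b k) dotv (c w) (noise k i w).
  by rewrite dotvZr dotv_sumr.
have isum : intble P (fun w => \sum_(i < b k) dotv (c w) (noise k i w)).
  by apply: intble_sum => i; have [] := o i.
split; first by under eq_fun do rewrite dE; exact: intbleZ.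
under eq_Rintegral do rewrite dE.
rewrite RintbleZ// Rintble_sum; last by move=> i; have [] := o i.
by rewrite big1 ?mulr0// => i _; have [] := o i.
Qed.

Let bounds : {ae P, forall w,
  loewner_le m%:M (hessian k w) /\ loewner_le (hessian k w) M%:M}.
Proof. exact: (run_bounds run). Qed.

Let drift w := (- alpha k) *: (hessian k w *m a k w) + (L * M ^+ 2 * alpha k ^+ 2) *: a k w.

(** The bound |A v| <= M |v| is applied to the whole v = a + e and the square is expanded
    afterwards. The cross term then contributes L M^2 alpha^2 <a, e>, the second summand of [drift];
    the first comes from the linear term of the descent lemma. *)
Let descent_step w : 0 <= alpha k ->
  loewner_le m%:M (hessian k w) -> loewner_le (hessian k w) M%:M ->
  f (x k.+1 w) <= f (x k w)
    - (m * alpha k - L * M ^+ 2 * alpha k ^+ 2 / 2) * dotv (a k w) (a k w)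
    + dotv (drift w) (err w)
    + L * M ^+ 2 * alpha k ^+ 2 / 2 * dotv (err w) (err w).
Proof.
move=> al0 mH HM.
have xE : x k.+1 w = x k w + (- alpha k) *: (hessian k w *m (a k w + err w)).
  by rewrite (run_step run)// batch_mean_err scaleNr.
rewrite xE; apply: (le_trans (descent L_gt0 f_smooth _ _)).
rewrite -/(a k w) dotvvZ dotvZr sqrrN.
have Hle := loewner_sqnorm_le (a k w + err w) m_gt0 M_gt0 mH HM.
have Hge := loewner_scal_geP (a k w) mH.
rewrite /drift dotvDl (dotvZl (- alpha k)) (dotvZl (L * _ * _)).
(* Symmetry of A_k, a consequence of the Loewner bound, moves it from the error onto the
   gradient. *)
have aHe : dotv (a k w) (hessian k w *m err w) = dotv (hessian k w *m a k w) (err w).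
  by rewrite dotvC [RHS]dotvC (dotv_symm _ _ (loewner_scal_symm mH)) dotvC.
have h1 : alpha k * (m * dotv (a k w) (a k w)) <=
    alpha k * dotv (a k w) (hessian k w *m a k w) by exact: ler_wpM2l.
have h2 : L / 2 * alpha k ^+ 2 * dotv (hessian k w *m (a k w + err w))
      (hessian k w *m (a k w + err w)) <=
    L / 2 * alpha k ^+ 2 * (M ^+ 2 * dotv (a k w + err w) (a k w + err w)).
  by apply: ler_wpM2l => //; rewrite mulr_ge0 ?sqr_ge0// divr_ge0// ltW.
move: h2; rewrite [dotv (a k w + _) (a k w + _)]dotvvD => h2.
have -> : dotv (a k w) (hessian k w *m (a k w + err w)) =
    dotv (a k w) (hessian k w *m a k w) + dotv (hessian k w *m a k w) (err w).
  by rewrite mulmxDr dotvDr aHe.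
lra.
Qed.

Lemma intble_sqgrad : intble P (fun w => f (x k w) - flow) ->
  intble P (fun w => dotv (a k w) (a k w)).
Proof.
move=> iF; apply: (ae_dominated_intble _ (intbleZ (2 * L) iF)).
  apply: measurable_dotv => j; apply: (measurable_T past_subD); exact: grad_measurable.
apply: aeW => w; rewrite ger0_norm ?dotvv_ge0//.
exact: (sqnorm_grad_le L_gt0 f_smooth).
Qed.

Let measurable_gap l : (1 <= l <= N.+1)%N ->
  measurable_fun setT (fun w => f (x l w) - flow).
Proof.
move=> /andP[l1 lN].
have sub : sample_index b l.-1 `<=` D by apply: index_mono; rewrite -ltnS prednK.
apply: (measurable_T sub); apply: measurable_funB => //.
have mf : measurable_fun setT (f : borel_cV R n -> R).
  apply: continuous_borel_cV => y; apply: differentiable_continuous.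
  by have [+ _ _ _] := f_smooth.
have mx := iterate_measurable (k := l); rewrite l1 lN in mx.
exact: (measurableT_comp mf (mx isT)).
Qed.

(** The descent inequality holds off a null set and is integrated. Integrability of the next gap is
    part of the conclusion, so that the step can be iterated. *)
Lemma expected_step : 0 <= alpha k ->
  intble P (fun w => f (x k w) - flow) ->
  intble P (fun w => f (x k.+1 w) - flow) /\
  \int[P]_w (f (x k.+1 w) - flow) +
    (m * alpha k - L * M ^+ 2 * alpha k ^+ 2 / 2) *
      \int[P]_w dotv (a k w) (a k w) <=
  \int[P]_w (f (x k w) - flow) +
    L * M ^+ 2 * alpha k ^+ 2 / 2 * (sigma ^+ 2 / (b k)%:R).
Proof.
move=> al0 iF.
have ia := intble_sqgrad iF.
have mHa j : measurable_fun setT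
    ((fun w => (hessian k w *m a k w) j 0) : TG (sample_index b k.-1) -> R).
  apply: measurable_mulmx_col => [i' j'|j']; first exact: hessian_measurable.
  exact: grad_measurable.
have sa j : sqintble P (fun w => a k w j 0).
  apply: (ae_dominated_sqintble _ ia).
    by apply: (measurable_T past_subD); exact: grad_measurable.
  by apply: aeW => w; exact: sqr_coord_le.
(* The matrix A_k is random but |A_k a_k|^2 <= M^2 |a_k|^2 almost everywhere, so no moment bound on
   its entries is required. *)
have sHa j : sqintble P (fun w => (hessian k w *m a k w) j 0).
  apply: (ae_dominated_sqintble _ (intbleZ (M ^+ 2) ia)).
    exact: (measurable_T past_subD).
  move: bounds; apply: (@filterS _ _ (ae_filter_ringOfSetsType P)) => w [mH HM].
  by apply: le_trans (loewner_sqnorm_le (a k w) m_gt0 M_gt0 mH HM); exact: sqr_coord_le.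
have [ic ec] : intble P (fun w => dotv (drift w) (err w)) /\
    \int[P]_w dotv (drift w) (err w) = 0.
  apply: err_orthogonal => j; under eq_fun do rewrite mxE [X in X + _]mxE [X in _ + X]mxE.
    by apply: measurable_funD; apply: measurable_funM => //; exact: grad_measurable.
  by apply: sqintbleD; exact: sqintbleZ.
set wt := m * alpha k - _; set kap := L * M ^+ 2 * _ / 2.
pose rhs w := (f (x k w) - flow) + ((- wt) * dotv (a k w) (a k w) +
  (dotv (drift w) (err w) + kap * dotv (err w) (err w))).
have i1 := intbleZ kap intble_err.
have i2 := intbleD ic i1.
have i3 := intbleZ (- wt) ia.
have i4 := intbleD i3 i2.
have irhs : intble P rhs := intbleD iF i4.
have step : {ae P, forall w, f (x k.+1 w) - flow <= rhs w}.
  move: bounds; apply: (@filterS _ _ (ae_filter_ringOfSetsType P)) => w [mH HM].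
  by have := descent_step al0 mH HM; rewrite /rhs -/wt -/kap; lra.
(* The gap is nonnegative, so the upper bound [rhs] alone dominates its absolute value. *)
have iF' : intble P (fun w => f (x k.+1 w) - flow).
  apply: (ae_dominated_intble _ irhs).
    by apply: measurable_gap; case/andP: kN => k1 kN'.
  move: step; apply: (@filterS _ _ (ae_filter_ringOfSetsType P)) => w.
  by rewrite ger0_norm// subr_ge0; have [_ _ + _] := f_smooth.
split => //.
have := ae_le_Rintble iF' irhs step.
rewrite (RintbleD iF i4) (RintbleD i3 i2) (RintbleD ic i1).
rewrite (RintbleZ _ ia) (RintbleZ _ intble_err) ec => h.
have h2 : kap * \int[P]_w dotv (err w) (err w) <= kap * (sigma ^+ 2 / (b k)%:R).
  apply: ler_wpM2l => //; rewrite /kap; apply: divr_ge0 => //.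
  by rewrite !mulr_ge0 ?sqr_ge0// ltW.
lra.
Qed.

End Iteration.

(** * Telescoping over the iterations and averaging over the random index *)

Lemma intble_gap k : (forall j, 0 <= alpha j) -> (1 <= k <= N.+1)%N ->
  intble P (fun w => f (x k w) - flow).
Proof.
move=> al0; elim: k => [//|k IHk] kN; case: k => [|k] in IHk kN *.
  by under eq_fun do rewrite (run_x1 run); exact: intble_cst.
have kN' : (1 <= k.+1 <= N)%N by [].
by have [] := expected_step kN' (al0 _) (IHk (ltnW kN)).
Qed.

Lemma expected_telescope : (forall j, 0 <= alpha j) ->
  \sum_(1 <= k < N.+1) (m * alpha k - L * M ^+ 2 * alpha k ^+ 2 / 2) *
      \int[P]_w dotv (a k w) (a k w) <=
  f x1 - flow + \sum_(1 <= k < N.+1)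
    L * M ^+ 2 * alpha k ^+ 2 / 2 * (sigma ^+ 2 / (b k)%:R).
Proof.
move=> al0.
have gap1 : \int[P]_w (f (x 1 w) - flow) = f x1 - flow.
  by under eq_Rintegral do rewrite (run_x1 run); rewrite Rintble_cst.
(* The final gap is kept for the induction and dropped at the end by nonnegativity. *)
suff: \int[P]_w (f (x N.+1 w) - flow) +
  \sum_(1 <= k < N.+1) (m * alpha k - L * M ^+ 2 * alpha k ^+ 2 / 2) *
      \int[P]_w dotv (a k w) (a k w) <=
  f x1 - flow + \sum_(1 <= k < N.+1)
    L * M ^+ 2 * alpha k ^+ 2 / 2 * (sigma ^+ 2 / (b k)%:R).
  apply: le_trans; rewrite lerDr; apply: Rintegral_ge0 => w _.
  by rewrite subr_ge0; have [_ _ + _] := f_smooth.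
have : (N <= N)%N by [].
(* Only the last iterate and the summation bounds vary; the horizon of the run stays fixed. *)
elim: {1 3 4 5}N => [_|k IHk kN].
  by rewrite !big_geq// !addr0 gap1.
have kN' : (1 <= k.+1 <= N)%N by [].
rewrite big_nat_recr//= [X in _ <= _ + X]big_nat_recr//=.
have kN1 : (1 <= k.+1 <= N.+1)%N by exact: leqW kN.
have [_ step] := expected_step kN' (al0 _) (intble_gap al0 kN1).
have := IHk (ltnW kN); lra.
Qed.

Let tau_indep (E : set T) (A : set nat) : <<s gen D >> E -> measurable A ->
  (P (E `&` tau @^-1` A) = P E * P (tau @^-1` A))%E.
Proof.
move=> EF mA; rewrite setIC muleC.
apply: (run_tau_indep run) => //.
by exists A => //; rewrite setTI.
Qed.

(** Here the samples are frozen and [tau] plays the independent variable: the inner integral is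
    |a_k|^2 times the probability that [tau] equals k. *)
Let intble_stopped k : (forall j, 0 <= alpha j) -> (1 <= k <= N)%N ->
  intble P (fun w => \1_(tau @^-1` [set k]) w * dotv (a k w) (a k w)) /\
  \int[P]_w (\1_(tau @^-1` [set k]) w * dotv (a k w) (a k w)) =
    pmf k * \int[P]_w dotv (a k w) (a k w).
Proof.
move=> al0 kN; have /andP[k1 kleN] := kN.
have kN1 : (1 <= k <= N.+1)%N by rewrite k1 ltnW.
have ia := intble_sqgrad kN (intble_gap al0 kN1).
have mtau : measurable (tau @^-1` [set k]).
  by rewrite -[X in measurable X]setTI; exact: (run_tau_meas run).
have mi : measurable_fun setT (fun w => \1_(tau @^-1` [set k]) w * dotv (a k w) (a k w)).
  by apply: measurable_funM => //; exact: intble_measurable ia.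
have i1 : intble P (fun w => \1_(tau @^-1` [set k]) w * dotv (a k w) (a k w)).
  apply: (ae_dominated_intble mi ia); apply: aeW => w.
  rewrite indicE; case: (w \in _); rewrite ?mul1r ?mul0r ?normr0 ?dotvv_ge0//.
  by rewrite ger0_norm ?dotvv_ge0.
split => //.
have sub : sample_index b k.-1 `<=` D.
  by apply: index_mono; rewrite (leq_trans (leq_pred _)).
have mk : measurable_fun setT (\1_[set k] : nat -> R).
  by apply: measurable_indic.
pose H (p : TG D * nat) : \bar R :=
  (\1_[set k] p.2 * dotv (a k p.1) (a k p.1))%:E.
have mH : measurable_fun setT H.
  apply/measurable_EFinP; apply: measurable_funM.
    exact: (measurableT_comp mk measurable_snd).
  have mg : measurable_fun setT ((fun w => dotv (a k w) (a k w)) : TG D -> R).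
    by apply: measurable_dotv => j; apply: (measurable_mono sub); exact: grad_measurable.
  exact: (measurableT_comp mg measurable_fst).
have H0 p : (0 <= H p)%E by rewrite lee_fin mulr_ge0 ?dotvv_ge0// indicE.
apply/EFin_inj; rewrite EFin_Rintble// EFinM EFin_Rintble//.
transitivity (\int[P]_w H (w, tau w))%E.
  by apply: eq_integral => w _; rewrite /H/= !indicE.
rewrite (ge0_integral_freeze (gen_measurable (@subset_refl _ D)) (run_tau_meas run)
  tau_indep mH H0).
rewrite -ge0_integralZl//; last 3 first.
- by apply/measurable_EFinP; exact: intble_measurable ia.
- by move=> w _; rewrite lee_fin dotvv_ge0.
- by rewrite -(run_tau_law run kN) measure_ge0.
apply: eq_integral => w _; rewrite /H/=.
under eq_integral do rewrite mulrC EFinM.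
rewrite ge0_integralZl//; last first.
- by rewrite lee_fin dotvv_ge0.
- apply/measurable_EFinP.
  exact: (measurableT_comp mk (run_tau_meas run)).
rewrite muleC; congr (_ * _)%E; rewrite -(run_tau_law run kN).
rewrite -[tau @^-1` _]setIT -integral_indic//.
Qed.

Lemma expected_stopped : (forall j, 0 <= alpha j) ->
  ('E_P[(fun w => norm2 (grad f (x (tau w) w)) ^+ 2)%R] =
  (\sum_(1 <= k < N.+1) pmf k * \int[P]_w dotv (a k w) (a k w))%R%:E)%E.
Proof.
move=> al0; rewrite unlock.
(* Extended by 0 outside 1..N, so that integrability holds for every index, as the lemmas on sums
   require. For each w only the term k = [tau w] survives. *)
pose g k w := if (1 <= k <= N)%N then
  \1_(tau @^-1` [set k]) w * dotv (a k w) (a k w) else 0.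
have ig k : intble P (g k).
  rewrite /g; case kN: (1 <= k <= N)%N; last exact: (intble_cst P 0).
  by have [] := intble_stopped al0 kN.
transitivity (\int[P]_w (\sum_(1 <= k < N.+1) g k w)%:E)%E.
  apply: eq_integral => w _; congr (_%:E); rewrite norm2_sq.
  have tN := run_tau_range run w.
  rewrite (bigD1_seq (tau w)) ?iota_uniq//=; last first.
    by rewrite mem_index_iota ltnS.
  rewrite big1 ?addr0.
    by rewrite /g tN indicE mem_set// mul1r.
  move=> k kt; rewrite /g; case: ifP => // _.
  by rewrite indicE memNset ?mul0r//= => tk; move: kt; rewrite tk eqxx.
rewrite -EFin_Rintble; last exact: intble_sum.
rewrite Rintble_sum//; congr (_%:E); apply: eq_big_nat => k; rewrite ltnS => kN.
by rewrite /g kN; have [] := intble_stopped al0 kN.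
Qed.

End Run.

(** * Arithmetic of the complexity bound *)

Section Complexity.
Context {R : realType}.
Implicit Types (eps z : R).

Lemma natr_absz_ceil z : 0 <= z -> (`|Num.ceil z|%N)%:R = (Num.ceil z)%:~R :> R.
Proof. by move=> z0; rewrite natr_absz ger0_norm// ceil_ge0; lra. Qed.

Lemma absz_ceil_ge z : z <= (`|Num.ceil z|%N)%:R.
Proof.
have [z0|z0] := leP 0 z; first by rewrite natr_absz_ceil// ceil_ge.
by rewrite (le_trans (ltW z0)).
Qed.

Lemma absz_ceil_lt z : 0 <= z -> (`|Num.ceil z|%N)%:R < z + 1.
Proof.
move=> z0; rewrite natr_absz_ceil//; have := ceilB1_lt z.
by rewrite intrB ltrBlDr.
Qed.

(** Expanding (eps a - c1)^2 / eps >= 0 and adding eps times the hypothesis gives 2 c1 a + 4 c2 <= 2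
    eps a^2, which suffices as c2 >= 0. It is applied with a the square root of the budget. *)
Lemma quadratic_le (c1 c2 eps a : R) : 0 < eps -> 0 <= c2 ->
  c1 ^+ 2 / eps ^+ 2 + 4 * c2 / eps <= a ^+ 2 -> c2 + c1 * a <= eps * a ^+ 2.
Proof.
move=> e0 c20 h.
have : eps * (c1 ^+ 2 / eps ^+ 2 + 4 * c2 / eps) <= eps * a ^+ 2.
  by apply: ler_wpM2l => //; exact: ltW.
have -> : eps * (c1 ^+ 2 / eps ^+ 2 + 4 * c2 / eps) = c1 ^+ 2 / eps + 4 * c2.
  by field; exact: lt0r_neq0.
have : 0 <= (eps * a - c1) ^+ 2 / eps by rewrite divr_ge0 ?sqr_ge0// ltW.
have -> : (eps * a - c1) ^+ 2 / eps = eps * a ^+ 2 - 2 * (c1 * a) + c1 ^+ 2 / eps.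
  by field; exact: lt0r_neq0.
lra.
Qed.

Context (L sigma m M D Df : R).
Context (L0 : 0 < L) (s0 : 0 < sigma) (m0 : 0 < m) (M0 : 0 < M) (D0 : 0 < D)
  (Df0 : 0 <= Df).

(** The left side is the bound on the mean squared gradient left by telescoping. The batch size
    enters only through inequalities, so the rounding is dealt with elsewhere. *)
Lemma complexity_bound eps (Nbar mb : nat) : 0 < eps -> (0 < Nbar)%N ->
  (0 < mb <= Nbar)%N ->
  mb%:R <= 1 + sigma / L * Num.sqrt (Nbar%:R / D) ->
  (mb = Nbar \/ sigma / L * Num.sqrt (Nbar%:R / D) <= mb%:R) ->
  Num.max ((4 * sigma * M ^+ 2 * Df / (m ^+ 2 * Num.sqrt D)
            + sigma * L * Num.sqrt D) ^+ 2 / eps ^+ 2 +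
      4 * (4 * L * M ^+ 2 * Df / m ^+ 2) / eps) (sigma ^+ 2 / (L ^+ 2 * D))
      <= Nbar%:R ->
  2 * L * M ^+ 2 * Df / ((Nbar %/ mb)%:R * m ^+ 2) + sigma ^+ 2 / mb%:R <= eps.
Proof.
move=> e0 N0 /andP[mb0 mbN] mbub mblb; rewrite ge_max => /andP[h1 h2].
set C1 := _ + sigma * L * Num.sqrt D in h1.
set C2 := 4 * L * M ^+ 2 * Df / m ^+ 2 in h1.
pose a := Num.sqrt (Nbar%:R : R); pose s := Num.sqrt D.
have NR0 : 0 < Nbar%:R :> R by rewrite ltr0n.
have bR0 : 0 < mb%:R :> R by rewrite ltr0n.
have a0 : 0 < a by rewrite sqrtr_gt0.
have sD0 : 0 < s by rewrite sqrtr_gt0.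
have a2 : a ^+ 2 = Nbar%:R by rewrite sqr_sqrtr// ltW.
have s2 : s ^+ 2 = D by rewrite sqr_sqrtr// ltW.
have yE : sigma / L * Num.sqrt (Nbar%:R / D) = sigma * a / (L * s).
  rewrite sqrtrM ?ler0n// sqrtrV ?ltW// -/a -/s; field.
  by apply/andP; split; exact: lt0r_neq0.
rewrite yE in mbub mblb.
have C20 : 0 <= C2.
  by rewrite /C2 divr_ge0 ?sqr_ge0// !mulr_ge0 ?sqr_ge0// ltW.
have N1 : (0 < Nbar %/ mb)%N by rewrite divn_gt0.
have NR1 : 0 < (Nbar %/ mb)%:R :> R by rewrite ltr0n.
(* The remainder of the division is below mb, itself at most mb times the quotient. Rounding down
   thus costs a factor 2, whence 4 rather than 2 in C2. *)
have Ndiv : Nbar%:R <= 2 * (Nbar %/ mb)%:R * mb%:R :> R.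
  rewrite -!natrM ler_nat {1}(divn_eq Nbar mb).
  rewrite -mulnA mul2n -addnn leq_add2l.
  by rewrite (leq_trans (ltnW (ltn_pmod _ mb0)))// leq_pmull.
have t1 : 2 * L * M ^+ 2 * Df / ((Nbar %/ mb)%:R * m ^+ 2) <= C2 * mb%:R / Nbar%:R.
  have -> : 2 * L * M ^+ 2 * Df / ((Nbar %/ mb)%:R * m ^+ 2) =
      C2 / (2 * (Nbar %/ mb)%:R).
    by rewrite /C2; field; apply/andP; split; exact: lt0r_neq0.
  rewrite ler_pdivrMr; last by rewrite mulr_gt0.
  have -> : C2 * mb%:R / Nbar%:R * (2 * (Nbar %/ mb)%:R) =
     C2 * (2 * (Nbar %/ mb)%:R * mb%:R) / Nbar%:R by ring.
  by rewrite ler_pdivlMr//; apply: ler_wpM2l.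
have t2 : C2 * mb%:R / Nbar%:R <= C2 * (1 + sigma * a / (L * s)) / Nbar%:R.
  by rewrite ler_pM2r ?invr_gt0//; apply: ler_wpM2l.
(* The square root of the second entry of the maximum; it is needed when the batch is the whole
   budget. *)
have las : sigma <= L * s * a.
  rewrite -(@ler_pXn2r _ 2)// ?nnegrE ?mulr_ge0 ?(ltW sD0) ?(ltW a0) ?(ltW L0) ?(ltW s0)//.
  rewrite !exprMn a2 s2; move: h2; rewrite ler_pdivrMr ?mulr_gt0 ?exprn_gt0//.
  by rewrite mulrC.
have t3 : sigma ^+ 2 / mb%:R <= sigma * L * s / a.
  case: mblb => [->|lb].
    rewrite -a2 ler_pdivrMr ?exprn_gt0//.
    have -> : sigma * L * s / a * a ^+ 2 = sigma * (L * s * a).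
      by field; exact: lt0r_neq0.
    by rewrite expr2; apply: ler_wpM2l => //; exact: ltW.
  have -> : sigma ^+ 2 = sigma * L * s / a * (sigma * a / (L * s)).
    by field; apply/and3P; split; exact: lt0r_neq0.
  rewrite ler_pdivrMr//; apply: ler_wpM2l => //.
  by rewrite divr_ge0 ?mulr_ge0 ?(ltW sD0) ?(ltW a0) ?(ltW L0) ?(ltW s0).
apply: (le_trans (lerD t1 t3)); apply: (le_trans (lerD t2 (lexx _))).
(* C1 is exactly the coefficient of a here: C2 sigma / (L s) + sigma L s. *)
have -> : C2 * (1 + sigma * a / (L * s)) / Nbar%:R + sigma * L * s / a =
    (C2 + C1 * a) / a ^+ 2.
  by rewrite -a2 /C1 /C2 -/s; field; rewrite !lt0r_neq0.
rewrite ler_pdivrMr ?exprn_gt0//; apply: quadratic_le => //.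
by rewrite a2.
Qed.

End Complexity.

(** * Growth of the oracle budget as the accuracy tends to 0 *)

Section Asymptotics.
Context {R : realType}.

Lemma natceil_eqO (c1 c2 c3 : R) : 0 <= c1 -> 0 <= c2 -> 0 <= c3 ->
  (fun eps : R => (2 * maxn 1 `|Num.ceil (Num.max (c1 / eps ^+ 2 + c2 / eps) c3)|)%:R : R)
    =O_ (0^'+) (fun eps : R => eps ^- 2 : R).
Proof.
move=> c10 c20 c30; apply/eqOP; near=> k; near=> eps.
have e0 : 0 < eps by near: eps; exact: nbhs_right_gt.
have e1 : eps < 1 by near: eps; exact: nbhs_right_lt.
have i1 : 1 <= eps^-1 by rewrite -[X in X <= _]invr1 lef_pV2 ?posrE// ltW.
have ii : eps^-1 <= eps ^- 2.
  by rewrite -exprVn expr2 ler_peMr// invr_ge0 ltW.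
have i2 : 1 <= eps ^- 2 by apply: le_trans ii.
set z := Num.max _ _.
have z0 : 0 <= z by rewrite /z le_max c30 orbT.
have zle : z <= (c1 + c2 + c3) * eps ^- 2.
  rewrite /z ge_max; apply/andP; split.
    have h2 := ler_wpM2l c20 ii.
    have h3 : 0 <= c3 * eps ^- 2 by rewrite mulr_ge0// (le_trans _ i2).
    lra.
  have h3 := ler_wpM2l c30 i2.
  have : 0 <= (c1 + c2) * eps ^- 2 by rewrite mulr_ge0 ?addr_ge0// (le_trans _ i2).
  lra.
have v0 : 0 <= eps ^- 2 by exact: le_trans i2.
rewrite (ger0_norm v0) ger0_norm ?ler0n//.
apply: (@le_trans _ _ (2 * (c1 + c2 + c3 + 2) * eps ^- 2)); last first.
  apply: ler_wpM2r; first by rewrite (le_trans _ i2).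
  by near: k; apply: nbhs_pinfty_ge; exact: num_real.
rewrite natrM -mulrA; apply: ler_wpM2l => //.
(* The 2 absorbs both the rounding and the maximum with 1; as 1 <= eps^-2, it joins the constant. *)
have h : (maxn 1 `|Num.ceil z|)%:R <= z + 2 :> R.
  have := absz_ceil_lt z0; rewrite /maxn; case: ifP => _; lra.
lra.
Unshelve. all: by end_near.
Qed.

End Asymptotics.

(** * The complexity theorem: rounding of the batch size and uniform stopping *)

Theorem theorem4p1 (R : realType) (n d : nat)
  (f : 'cV[R]_n -> R) (flow L : R)
  (Xi : set 'cV[R]_d) (G : 'cV[R]_n -> 'cV[R]_d -> 'cV[R]_n) (sigma : R)
  (x1 : 'cV[R]_n) (B1 : 'M[R]_n) (m M delta D : R)
  (L_gt0 : 0 < L) (f_smooth : smooth_objective f flow L)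
  (G_meas : measurable_fun setT
     (fun p : borel_cV R n * borel_cV R d => G p.1 p.2 : borel_cV R n))
  (sigma_gt0 : 0 < sigma) (B1_pos : posdefmx B1)
  (m_gt0 : 0 < m) (M_gt0 : 0 < M) (delta_gt0 : 0 < delta) (D_gt0 : 0 < D) :
  let Df := f x1 - flow in
  let C1 := 4 * sigma * M ^+ 2 * Df / (m ^+ 2 * Num.sqrt D)
            + sigma * L * Num.sqrt D in
  let C2 := 4 * L * M ^+ 2 * Df / m ^+ 2 in
  let large_enough (eps : R) (Nbar : nat) :=
    Num.max (C1 ^+ 2 / eps ^+ 2 + 4 * C2 / eps) (sigma ^+ 2 / (L ^+ 2 * D))
      <= Nbar%:R in
  let mbar (Nbar : nat) : nat :=
    `|Num.ceil (Num.min Nbar%:R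
        (Num.max 1 (sigma / L * Num.sqrt (Nbar%:R / D))))%R|%N in
  let alpha (k : nat) := m / (L * M ^+ 2) in
  let reaches (eps : R) (Nbar : nat) :=
    let N := (Nbar %/ mbar Nbar)%N in
    let b (k : nat) := mbar Nbar in
    forall (dT : measure_display) (T : measurableType dT) (P : probability T R)
      (zeta : nat -> R) (xi : nat -> nat -> T -> 'cV[R]_d) (tau : T -> nat)
      (x : nat -> T -> 'cV[R]_n) (B : nat -> T -> 'M[R]_n),
    rsqn_run G P f Xi sigma m M delta x1 B1 N b alpha
      (stop_pmf m M L alpha N) zeta xi tau x B ->
    ('E_P[(fun w => norm2 (grad f (x (tau w) w)) ^+ 2)%R] <= eps%:E)%E /\
    (forall w, (sfo_calls b (tau w) <= 2 * Nbar)%N) in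
  (forall (eps : R) (Nbar : nat), 0 < eps -> (0 < Nbar)%N ->
     large_enough eps Nbar -> reaches eps Nbar) /\
  (exists Nbar : R -> nat,
     (forall eps, 0 < eps ->
        [/\ (0 < Nbar eps)%N, large_enough eps (Nbar eps)
          & reaches eps (Nbar eps)]) /\
     (fun eps : R => (2 * Nbar eps)%:R : R) =O_ (0^'+)
       (fun eps : R => eps ^- 2 : R)).
Proof.
move=> Df C1 C2 large_enough mbar alpha reaches.
have Df0 : 0 <= Df by rewrite subr_ge0; have [_ _ + _] := f_smooth.
suff main : forall (eps : R) (Nbar : nat), 0 < eps -> (0 < Nbar)%N ->
    large_enough eps Nbar -> reaches eps Nbar.
  split => //.
  (* The witness is the lower bound on the budget rounded up to a positive integer. *)
  pose bnd (eps : R) : R :=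
    Num.max (C1 ^+ 2 / eps ^+ 2 + 4 * C2 / eps) (sigma ^+ 2 / (L ^+ 2 * D)).
  exists (fun eps => maxn 1 `|Num.ceil (bnd eps)|); split => [eps e0|].
    have Nb1 : (0 < maxn 1 `|Num.ceil (bnd eps)|)%N by rewrite leq_max.
    have lrg : large_enough eps (maxn 1 `|Num.ceil (bnd eps)|).
      by rewrite /large_enough (le_trans (absz_ceil_ge _))// ler_nat leq_max leqnn orbT.
    by split => //; exact: main.
  apply: natceil_eqO; first exact: sqr_ge0.
    by rewrite mulr_ge0// divr_ge0 ?sqr_ge0// !mulr_ge0 ?sqr_ge0// ltW.
  by rewrite divr_ge0 ?sqr_ge0// mulr_ge0 ?sqr_ge0// ltW.
move=> eps Nbar e0 Nb0 lrg; rewrite /reaches => dT T P zeta xi tau x B run.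
set mb := mbar Nbar in run *.
set y := sigma / L * Num.sqrt (Nbar%:R / D).
have y0 : 0 <= y by rewrite mulr_ge0 ?sqrtr_ge0// divr_ge0// ltW.
set z := Num.min Nbar%:R (Num.max 1 y).
have z1 : 1 <= z by rewrite /z le_min ler1n Nb0/= le_max lexx.
have zmb : z <= mb%:R by exact: absz_ceil_ge.
have mb0 : (0 < mb)%N by rewrite -(ltr_nat R) (lt_le_trans ltr01)// (le_trans z1).
have mbN : (mb <= Nbar)%N.
  rewrite -(ler_nat R) /mb /mbar natr_absz_ceil ?(le_trans ler01)//.
  by rewrite -[leRHS]/(Nbar%:~R) ler_int ceil_le_int ge_min lexx.
have mblt : mb%:R < z + 1 by apply: absz_ceil_lt; exact: le_trans z1.
have mbub : mb%:R <= 1 + y.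
  have zle : z <= Num.max 1 y by rewrite /z ge_min lexx orbT.
  (* When y <= 1, rounding up from z <= 1 gives only mb < 2; integrality then yields mb <= 1 <= 1 +
     y. *)
  have [y1|y1] := leP y 1.
    have : (mb%:R : R) < 2%:R by move: zle; rewrite (max_l y1); lra.
    by rewrite ltr_nat ltnS -(ler_nat R) => /le_trans; apply; rewrite lerDl.
  by move: zle; rewrite (max_r (ltW y1)); lra.
have mblb : mb = Nbar \/ y <= mb%:R.
  have [yN|yN] := leP (Num.max 1 y) Nbar%:R.
    right; apply: le_trans zmb; rewrite /z (min_r yN).
    by rewrite le_max lexx orbT.
  left; apply/eqP; rewrite eqn_leq mbN/= -(ler_nat R); apply: le_trans zmb.
  by rewrite /z (min_l (ltW yN)).
set N := (Nbar %/ mb)%N in run *.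
have N0 : (0 < N)%N by rewrite divn_gt0.
split; last first.
  move=> w; have /andP[_ tN] := run_tau_range run w.
  (* Each iteration costs 2 mb calls, at most N iterations are run, and N mb <= Nbar since N is the
     rounded-down quotient. *)
  rewrite /sfo_calls sum_nat_const_nat subn1/= addnn -mul2n mulnCA leq_mul2l/=.
  by rewrite (leq_trans (leq_mul tN (leqnn mb)))// leq_trunc_div.
have b0 (k : nat) : (0 < (fun=> mb) k)%N by [].
have al0 j : 0 <= alpha j.
  by rewrite /alpha divr_ge0 ?mulr_ge0 ?sqr_ge0// ltW.
rewrite (expected_stopped L_gt0 f_smooth G_meas m_gt0 M_gt0 b0 run al0).
have := expected_telescope L_gt0 f_smooth G_meas m_gt0 M_gt0 b0 run al0.
rewrite lee_fin.
set g := fun k => \int[P]_w dotv (grad f (x k w)) (grad f (x k w)).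
(* For alpha = m / (L M^2) the decrease weight and the noise coefficient coincide, both being m^2 /
   (2 L M^2). This also makes the stopping law uniform. *)
pose wt := m ^+ 2 / (2 * L * M ^+ 2).
have wt0 : 0 < wt by rewrite divr_gt0 ?mulr_gt0 ?exprn_gt0.
have NR0 : 0 < N%:R :> R by rewrite ltr0n.
have nz : [/\ L != 0, M != 0, m != 0 & N%:R != 0 :> R] by split; exact: lt0r_neq0.
have wtE k : m * alpha k - L * M ^+ 2 * alpha k ^+ 2 / 2 = wt.
  by rewrite /alpha /wt; have [L1 M1 m1 _] := nz; field; rewrite L1 M1.
have kapE k : L * M ^+ 2 * alpha k ^+ 2 / 2 = wt.
  by rewrite /alpha /wt; have [L1 M1 m1 _] := nz; field; rewrite L1 M1.
have sumwt : \sum_(1 <= j < N.+1) (m * alpha j - L * M ^+ 2 * alpha j ^+ 2 / 2) =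
    N%:R * wt.
  under eq_bigr do rewrite wtE.
  by rewrite sumr_const_nat subn1/= mulr_natl.
have pmfE k : stop_pmf m M L alpha N k = N%:R^-1.
  rewrite /stop_pmf sumwt wtE invfM mulrCA mulfV ?mulr1//; exact: lt0r_neq0.
under eq_bigr do rewrite wtE.
under [X in _ <= _ + X -> _]eq_bigr do rewrite kapE.
under [X in _ -> X <= _]eq_bigr do rewrite pmfE.
rewrite [X in _ <= _ + X -> _]sumr_const_nat subn1/=.
rewrite -[X in _ <= _ + X -> _]mulr_natl -!mulr_sumr -/Df => tele.
have mbN0 : (0 < mb <= Nbar)%N by rewrite mb0.
apply: le_trans (complexity_bound L_gt0 sigma_gt0 m_gt0 M_gt0 D_gt0 Df0 e0 Nb0
  mbN0 mbub mblb lrg).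
rewrite -/N.
have -> : 2 * L * M ^+ 2 * Df / (N%:R * m ^+ 2) + sigma ^+ 2 / mb%:R =
    (Df + N%:R * (wt * (sigma ^+ 2 / mb%:R))) / (N%:R * wt).
  have [L1 M1 m1 N1] := nz; rewrite /wt; field.
  by rewrite L1 M1 m1 N1 pnatr_eq0 -lt0n mb0.
rewrite ler_pdivlMr; last exact: mulr_gt0.
have -> : N%:R^-1 * (\sum_(1 <= i < N.+1) g i) * (N%:R * wt) =
    wt * \sum_(1 <= i < N.+1) g i.
  by have [_ _ _ N1] := nz; field.
exact: tele.
Qed.
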